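(* For all integers $k, d$ there exists a constant $c=c(k,d)$ such that if $H$ is a graph of maximum degree $d$ and treewidth at most $k$, then $$\hat r(H) \le c\,|V(H)|.$$
   Context: Graphs are finite and simple. A graph $G$ is Ramsey for a graph $H$, written $G\to H$, if every $2$-colouring of the edges of $G$ contains a monochromatic copy of $H$ (as a not necessarily induced subgraph). The size Ramsey number $\hat r(H)$ is the minimum number of edges in a graph $G$ that is Ramsey for $H$. The treewidth of a graph $G$ is the minimum integer $w$ such that $G$ is a subgraph of a chordal graph with no $(w+2)$-clique. *)

(* Defs.v *)
From mathcomp Require Import all_boot all_order all_algebra.
From mathcomp Require Import boolp zify.

Set Implicit Arguments.
Unset Strict Implicit.
Unset Printing Implicit Defensive.

Record sgraph := SGraph {
  svertex :> finType;
  sedge : rel svertex;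
  sedge_sym : symmetric sedge;
  sedge_irrefl : irreflexive sedge }.

Definition edges (G : sgraph) : {set {set G}} :=
  [set [set x; y] | x in G, y in G & sedge x y].

Definition max_degree (G : sgraph) : nat :=
  \max_(x : G) #|[set y | sedge x y]|.

(* Containment up to isomorphism; not necessarily induced or spanning. *)
Definition is_subgraph (H G : sgraph) : Prop :=
  exists2 f : H -> G, injective f & {homo f : x y / sedge x y}.

Section ColourClass.
Variables (G : sgraph) (col : {set G} -> bool) (b : bool).

Definition colour_rel : rel G :=
  fun x y => sedge x y && (col [set x; y] == b).

Lemma colour_rel_sym : symmetric colour_rel.
Proof. by move=> x y; rewrite /colour_rel sedge_sym setUC. Qed.

Lemma colour_rel_irrefl : irreflexive colour_rel.
Proof. by move=> x; rewrite /colour_rel sedge_irrefl. Qed.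

Definition colour_class : sgraph := SGraph colour_rel_sym colour_rel_irrefl.
End ColourClass.

(* A colouring is given on all sets of vertices; only its values on [edges G]
   matter. *)
Definition ramsey_for (G H : sgraph) : Prop :=
  forall col : {set G} -> bool,
    exists b : bool, is_subgraph H (colour_class col b).

Definition clique (G : sgraph) (S : {set G}) : Prop :=
  {in S &, forall x y, x != y -> sedge x y}.

Definition chordal (G : sgraph) : Prop :=
  forall p : seq G, cycle (@sedge G) p -> uniq p -> 4 <= size p ->
    exists x y : G,
      [/\ x \in p, y \in p, sedge x y, y != next p x & x != next p y].

Definition complete_rel (T : finType) : rel T := fun x y => x != y.

Lemma complete_rel_sym T : symmetric (@complete_rel T).
Proof. by move=> x y; rewrite /complete_rel eq_sym. Qed.

Lemma complete_rel_irrefl T : irreflexive (@complete_rel T).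
Proof. by move=> x; rewrite /complete_rel eqxx. Qed.

Definition complete (T : finType) : sgraph :=
  SGraph (@complete_rel_sym T) (@complete_rel_irrefl T).

Definition chordal_completion (G : sgraph) (m : nat) : Prop :=
  exists C : sgraph, [/\ chordal C, is_subgraph G C &
    forall S : {set C}, clique S -> #|S| <> m].

Lemma complete_chordal T : chordal (complete T).
Proof.
move=> [|x [|y [|z [|t p]]]] //= _ /and5P[xN yN zN tN _] _.
move: xN yN zN; rewrite !inE !negb_or => /and4P[xy xz xt _] /and3P[yz yt _].
move=> /andP[zt _].
exists x, z; split; rewrite ?inE ?eqxx ?orbT //=.
- by rewrite eq_sym.
- by rewrite eq_sym in xz; rewrite eq_sym in yz; rewrite (negPf xz) (negPf yz).
Qed.

Lemma chordal_completion_ex (G : sgraph) :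
  exists n, `[< chordal_completion G n.+1 >].
Proof.
exists #|G|; apply/asboolP; exists (complete G); split.
- exact: complete_chordal.
- exists id => // x y; rewrite /= /complete_rel => xy.
  by apply: contraTneq xy => ->; rewrite sedge_irrefl.
- by move=> S _ SE; move: (max_card (mem S)); rewrite SE ltnn.
Qed.

(* The least integer w such that G is a subgraph of a chordal graph without
   (w+2)-clique. As the empty set is a clique, w >= -1; hence the minimum is
   taken over n = w + 1 in nat. The graph without vertices has treewidth -1. *)
Definition treewidth (G : sgraph) : int :=
  ((ex_minn (chordal_completion_ex G))%:Z - 1)%R.

Lemma ramsey_sets (T : finType) (r : rel T) (s a b : nat) (A : {set T}) :
  symmetric r -> a + b <= s -> 2 ^ s <= #|A| ->
  exists c : bool, exists2 S : {set T}, #|S| = (if c then a else b) &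
    S \subset A /\ {in S &, forall x y, x != y -> r x y = c}.
Proof.
move=> rC; elim: s a b A => [|s IHs] a b A abs sA.
  exists true, set0; first by rewrite cards0; lia.
  by split; [exact: sub0set | move=> x y; rewrite inE].
case: a abs => [|a] abs.
  exists true, set0; first by rewrite cards0.
  by split; [exact: sub0set | move=> x y; rewrite inE].
case: b abs => [|b] abs.
  exists false, set0; first by rewrite cards0.
  by split; [exact: sub0set | move=> x y; rewrite inE].
have /card_gt0P[v vA] : 0 < #|A| by apply: leq_trans sA; rewrite expn_gt0.
pose N c := [set x in A | (x != v) && (r v x == c)].
have NA c : N c \subset A by apply/subsetP=> x; rewrite inE => /andP[].
have vN c : v \notin N c by rewrite inE eqxx andbF.
have cardN : #|A| = #|N true| + #|N false| + 1.
  rewrite (cardsD1 v) vA addnC; congr (_ + _).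
  rewrite -(cardsID [set x | r v x]); congr (_ + _); apply: eq_card => x;
    by rewrite !inE; case: (r v x); case: (x == v); case: (x \in A).
have ext c (S : {set T}) : S \subset N c ->
    {in S &, forall x y, x != y -> r x y = c} ->
    [/\ #|v |: S| = #|S|.+1, v |: S \subset A &
      {in v |: S &, forall x y, x != y -> r x y = c}].
  move=> SN Sc.
  have Nr x : x \in S -> r v x = c.
    by move=> /(subsetP SN); rewrite inE => /and3P[_ _ /eqP].
  split.
  - by rewrite cardsU1 (contra (subsetP SN v) (vN c)).
  - by rewrite subUset sub1set vA (subset_trans SN (NA c)).
  - move=> x y; rewrite !inE => /orP[/eqP->|xS] /orP[/eqP->|yS].
    + by rewrite eqxx.
    + by move=> _; exact: Nr.
    + by move=> _; rewrite rC; exact: Nr.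
    + exact: Sc.
have [big|big] : 2 ^ s <= #|N true| \/ 2 ^ s <= #|N false|.
  by move: sA; rewrite expnS; lia.
- have [|[] [S SE [SN Sc]]] := IHs a b.+1 (N true) _ big; first by lia.
  + have [E SA Sc'] := ext _ S SN Sc.
    by exists true, (v |: S); [rewrite E SE | split].
  + by exists false, S => //; split=> //; exact: subset_trans SN (NA _).
- have [|[] [S SE [SN Sc]]] := IHs a.+1 b (N false) _ big; first by lia.
  + by exists true, S => //; split=> //; exact: subset_trans SN (NA _).
  + have [E SA Sc'] := ext _ S SN Sc.
    by exists false, (v |: S); [rewrite E SE | split].
Qed.

Lemma ramsey_for_ex (H : sgraph) :
  exists m, `[< exists2 G : sgraph, #|edges G| = m & ramsey_for G H >].
Proof.
set N := 2 ^ (#|H| + #|H|); pose K := complete 'I_N.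
exists #|edges K|; apply/asboolP; exists K => // col.
have [||c [S]] := @ramsey_sets 'I_N (fun x y => col [set x; y])
    (#|H| + #|H|) #|H| #|H| [set: 'I_N] _ (leqnn _).
- by move=> x y; rewrite setUC.
- by rewrite cardsT card_ord.
rewrite if_same => SE [_ Sc]; exists c.
have lt (x : H) : enum_rank x < #|S| by rewrite SE; exact: ltn_ord.
exists (fun x : H => enum_val (Ordinal (lt x))) => [x y /enum_val_inj[]|x y xy].
  by move=> /val_inj /enum_rank_inj.
have xy' : x != y by apply: contraTneq xy => ->; rewrite sedge_irrefl.
have E : enum_val (Ordinal (lt x)) != enum_val (Ordinal (lt y)) :> 'I_N.
  by apply: contra_neq xy' => /enum_val_inj[] /val_inj /enum_rank_inj.
by rewrite /= /colour_rel /= /complete_rel E (Sc _ _ _ _ E) ?eqxx ?enum_valP.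
Qed.

Definition size_ramsey (H : sgraph) : nat := ex_minn (ramsey_for_ex H).

(* Main.v *)
Require Import Defs.
From mathcomp Require Import all_boot all_order all_algebra.
From mathcomp Require Import boolp zify.

(** A graph [H] of bounded degree and treewidth has a tree partition of bounded
    width along a tree of bounded degree, because chordal graphs have balanced
    clique separators. The host graph [G] is obtained from a sparse random
    digraph on [O(|H|)] vertices, in which any two sets of linear size span an
    edge, by joining vertices connected by a short directed path and replacing
    every vertex by a clique of large constant size.

    Given a 2-colouring of [G], a positive proportion of these cliques contain a
    monochromatic clique, say blue, in the same position [S]. Split them into [2 w]
    parts. For two parts and [A, B] inside [S], either the blue complete bipartite
    graphs between [A] and [B] carry a copy of the tree, which by the
    Friedman-Pippenger theorem happens unless two large subsets of the parts have
    none of them, and then [H] is blue; or we pass to these subsets. If no blue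
    copy ever appears, all parts end up without a blue [K_{w,w}] between them. The
    digraph then contains the tree with every vertex replaced by a path on [w]
    vertices, running cyclically through the parts, and one vertex can be chosen
    greedily in each clique so that all the edges needed for [H] are red. *)

Set Implicit Arguments.
Unset Strict Implicit.
Unset Printing Implicit Defensive.

(** * Friedman-Pippenger tree embedding *)

Section OutNeighbours.
Variables (V : finType) (R : rel V).
Implicit Types (x y : V) (X Y Z F U : {set V}).

Definition outn X := [set y | [exists x in X, R x y]].

Lemma outnP X y : reflect (exists2 x, x \in X & R x y) (y \in outn X).
Proof.
rewrite inE; apply: (iffP existsP) => [[x /andP[]]|[x xX xy]]; first by exists x.
by exists x; rewrite xX.
Qed.

Lemma outnU X Y : outn (X :|: Y) = outn X :|: outn Y.
Proof.
apply/setP=> y; apply/outnP/setUP.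
  by case=> x /setUP[] xX xy; [left|right]; apply/outnP; exists x.
by case=> /outnP[x xX xy]; exists x => //; rewrite inE xX ?orbT.
Qed.

Lemma outnS X Y : X \subset Y -> outn X \subset outn Y.
Proof.
by move=> XY; apply/subsetP=> y /outnP[x /(subsetP XY) xY xy]; apply/outnP; exists x.
Qed.

Section FriedmanPippenger.
Variables (U : {set V}) (D n : nat).

(* [F] is the set of used vertices and [c x] is the number of children that may
   still be attached to [x]. *)
Definition good F (c : V -> nat) := forall X, X \subset U -> #|X| <= n.*2 ->
  \sum_(x in X) c x <= #|outn X :\: F|.

Hypothesis expand : forall X, X \subset U -> #|X| <= n.*2 ->
  D.+1 * #|X| <= #|outn X|.

Section Step.
Variables (F : {set V}) (c : V -> nat).
Hypotheses (cD : forall x, c x <= D) (Fn : #|F| < n) (goodF : good F c).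

(** Tight sets. The bound [n] on their size lets the union of two of them stay within [n.*2]. *)
Let critical X :=
  [&& X \subset U, #|X| < n & #|outn X :\: F| == \sum_(x in X) c x].

Lemma sum_capacity X : \sum_(x in X) c x <= D * #|X|.
Proof.
by rewrite mulnC -sum_nat_const; apply: leq_sum => x _; exact: cD.
Qed.

(** Expansion gives [D.+1 * #|X| <= #|outn X| <= D * #|X| + #|F|], so a tight set of size up to
    [n.*2] has at most [#|F| < n] elements. *)
Lemma critical_small X : X \subset U -> #|X| <= n.*2 ->
  #|outn X :\: F| <= \sum_(x in X) c x -> critical X.
Proof.
move=> XU Xn le; have eq := goodF XU Xn.
rewrite /critical XU eqn_leq le eq /= andbT.
have := expand XU Xn; have := sum_capacity X.
have : #|outn X| <= #|outn X :\: F| + #|F|.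
  by rewrite -(cardsID F (outn X)) addnC leq_add2l subset_leq_card ?subsetIr.
by rewrite mulSn; lia.
Qed.

(** The capacity sum is modular and [#|outn X :\: F|] is submodular; as goodness applies to the
    intersection, equality for [X] and [Y] passes to the union. *)
Lemma criticalU X Y : critical X -> critical Y -> critical (X :|: Y).
Proof.
move=> /and3P[XU Xn /eqP cX] /and3P[YU Yn /eqP cY].
have IU : X :&: Y \subset U by rewrite (subset_trans (subsetIl _ _)).
have In : #|X :&: Y| <= n.*2.
  by apply: leq_trans (subset_leq_card (subsetIl _ _)) _; rewrite -addnn; lia.
have gI := goodF IU In.
apply: critical_small; first by rewrite subUset XU.
  by apply: leq_trans (leq_card_setU X Y).1 _; rewrite -addnn; lia.
have modular : \sum_(x in X :|: Y) c x + \sum_(x in X :&: Y) c x =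
    \sum_(x in X) c x + \sum_(x in Y) c x.
  rewrite (big_setID X) /= setUK [X in _ = _ + X](big_setID X) /=.
  by rewrite setDUl setDv set0U (setIC Y) /=; lia.
have submod : #|outn (X :|: Y) :\: F| + #|outn (X :&: Y) :\: F| <=
    #|outn X :\: F| + #|outn Y :\: F|.
  rewrite outnU setDUl -[X in _ <= X]cardsUI leq_add2l subset_leq_card // subsetI.
  by rewrite !setSD ?outnS ?subsetIl ?subsetIr.
lia.
Qed.

(** If no new child [y] of [x] keeps goodness, each candidate [y] is seen by a critical set avoiding
    [x]. The union [XS] of all critical sets avoiding [x] is critical and sees every candidate, so
    adding [x] raises the demand by [c x] without new out-neighbours, against goodness. *)
Lemma good_step x : x \in U -> 0 < c x ->
  exists y, [/\ y \notin F, R x y &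
    good (y |: F) (fun z => if z == x then (c z).-1 else c z)].
Proof.
move=> xU cx; apply: contrapT => none.
pose c' z := if z == x then (c z).-1 else c z.
have X_ y : y \in outn [set x] :\: F ->
    exists X, [/\ critical X, x \notin X & y \in outn X].
  rewrite !inE => /andP[yF /existsP[x' /andP[/set1P-> xy]]].
  have : ~ good (y |: F) c' by move=> gd; apply: none; exists y.
  move=> /existsNP[X /not_implyP[XU /not_implyP[Xn /negP bad]]].
  have gX := goodF XU Xn; exists X; move: bad; rewrite -ltnNge => bad.
  have h1 : #|outn X :\: F| <= #|outn X :\: (y |: F)| + (y \in outn X).
    rewrite (cardsD1 y (outn X :\: F)) setDDl setUC addnC leq_add2l inE.
    by case: (y \in F).
  have h2 : \sum_(z in X) c z = \sum_(z in X) c' z + (x \in X).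
    case: (boolP (x \in X)) => xX.
      rewrite !(big_setD1 x xX) /= /c' eqxx.
      rewrite [X in _ = _ + X + _](eq_bigr c); first by lia.
      by move=> z; rewrite !inE => /andP[/negPf->].
    rewrite addn0; apply: eq_bigr => z zX; rewrite /c'.
    by case: eqP zX xX => // -> ->.
  have yX : y \in outn X by move: h1 h2 bad gX; case: (y \in _); lia.
  have xX : x \notin X.
    by move: h1 h2 bad gX; rewrite yX; case: (x \in _) => //; lia.
  split=> //; apply: critical_small => //.
  by move: h1 h2; rewrite yX (negPf xX); lia.
pose XS := \bigcup_(X | critical X && (x \notin X)) X.
have crit0 : critical set0.
  apply/and3P; split; first exact: sub0set.
    by rewrite cards0; lia.
  rewrite big_set0 cards_eq0; apply/eqP/setP=> y; rewrite !inE.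
  by case: existsP => [[z]|]; rewrite ?inE ?andbF.
have /andP[critXS xXS] : critical XS && (x \notin XS).
  apply: (big_ind (fun X => critical X && (x \notin X))) => //.
    by rewrite crit0 inE.
  move=> X Y /andP[cX xX] /andP[cY xY]; rewrite criticalU //= inE.
  by rewrite negb_or xX.
have [XSU XSn /eqP eXS] := and3P critXS.
have xXSU : x |: XS \subset U by rewrite subUset sub1set xU.
have := goodF xXSU; rewrite cardsU1 xXS big_setU1 //= => /(_ ltac:(lia)).
rewrite -eXS outnU setDUl (setUidPr _); first by lia.
apply/subsetP=> y yx; have [X [cX xX yX]] := X_ y yx.
rewrite inE; move: (yx); rewrite inE => /andP[-> _] /=.
move/outnP: yX => [z zX zy]; apply/outnP; exists z => //.
by apply/bigcupP; exists X => //; rewrite cX.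
Qed.
End Step.

Section Tree.
Variables (T : eqType) (r : T) (par : T -> T) (rank : T -> nat).

Definition childcount (l : seq T) a := count (fun b => (b != r) && (par b == a)) l.

Definition par_closed (l : seq T) :=
  {in l, forall a, a != r -> par a \in l /\ rank (par a) < rank a}.

(** In a list sorted by decreasing rank the head is nobody's parent, so the tree can be built by
    attaching leaves one at a time. The root, of rank 0, is the head only when it is alone. *)
Lemma par_closed_behead a (l : seq T) : rank r = 0 ->
  sorted (fun a b => rank b <= rank a) (a :: l) -> uniq (a :: l) ->
  par_closed (a :: l) -> par_closed l /\ (a = r -> l = [::]).
Proof.
move=> r0 srt /andP[al _] cl.
have le b : b \in l -> rank b <= rank a.
  move=> bl; have := order_path_min _ srt => /(_ _)/allP; apply => //.
  by move=> x y z h1 h2; apply: leq_trans h2 h1.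
split=> [b bl br|ar].
  have [|pl lt] := cl b _ br; first by rewrite inE bl orbT.
  split=> //; move: pl; rewrite inE => /orP[/eqP pa|//].
  by have := le b bl; rewrite -pa leqNgt lt.
case: l le cl al {srt} => // b l le cl al.
have br : b != r by rewrite -ar; apply: contra al => /eqP<-; rewrite inE eqxx.
have [|_] := cl b _ br; first by rewrite !inE eqxx orbT.
by have := le b (mem_head _ _); rewrite ar r0; lia.
Qed.

Lemma embed_sorted (x0 : V) (l : seq T) : rank r = 0 -> x0 \in U ->
  (forall x y, R x y -> y \in U) ->
  sorted (fun a b => rank b <= rank a) l -> uniq l -> par_closed l ->
  (forall a, childcount l a <= D) -> size l <= n ->
  exists phi : T -> V, [/\ {in l &, injective phi},
    {in l, forall a, phi a \in U} &
    {in l, forall a, a != r -> R (phi (par a)) (phi a)}].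
Proof.
move=> r0 x0U RU srt ul cl ch sl.
suff [phi [c [phiI phiU phiR _]]] : exists phi : T -> V, exists c : V -> nat,
    [/\ {in l &, injective phi}, {in l, forall a, phi a \in U},
       {in l, forall a, a != r -> R (phi (par a)) (phi a)} &
      [/\ forall x, c x <= D, forall x, x \notin map phi l -> c x = D & (l != [::] ->
        good [set x in map phi l] c /\
        {in l, forall a, D <= c (phi a) + childcount l a})]].
  by exists phi.
elim: l srt ul cl ch sl => [|a l IHl] srt ul cl ch sl.
  by exists (fun _ => x0), (fun _ => D); split=> //; split.
have [cl' lr] := par_closed_behead r0 srt ul cl.
have [al ul'] := andP ul.
have ch' b : childcount l b <= D by apply: leq_trans (ch b); rewrite /= leq_addl.
have [phi [c [phiI phiU phiR [cD cF gd]]]] :=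
  IHl (path_sorted srt) ul' cl' ch' (ltnW sl).
case: (eqVneq a r) => [ar|ar].
  rewrite (lr ar) {lr}.
  exists (fun _ => x0), (fun _ => D); split.
  - by move=> x y; rewrite !inE => /eqP-> /eqP->.
  - by [].
  - by move=> x; rewrite inE ar => /eqP->; rewrite eqxx.
  (* Only the root is placed. It hides at most one out-neighbour, which the surplus of [D.+1] over
     [D] pays for. *)
  - split=> // _; split=> [|b _]; last by rewrite leq_addr.
    move=> X XU Xn; have := expand XU Xn; rewrite sum_nat_const.
    case: (set_0Vmem X) => [->|[x xX]]; first by rewrite cards0.
    have : 0 < #|X| by rewrite (cardsD1 x) xX.
    have : #|outn X| <= #|outn X :\: [set x in map (fun=> x0) [:: a]]| + 1.
      rewrite -(cardsID [set x0] (outn X)) addnC leq_add //.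
        by rewrite subset_leq_card //; apply/subsetP=> y; rewrite !inE.
      by rewrite -(cards1 x0) subset_leq_card // subsetIr.
    rewrite mulSn (mulnC D); move: (#|X| * D) #|X| #|outn X| #|outn X :\: _|.
    by clear; lia.
have pl : par a \in l.
  have [] := cl a (mem_head _ _) ar.
  by rewrite inE => /orP[/eqP->|//]; rewrite ltnn.
have [|gd1 gd2] := gd; first by case: (l) pl.
(* [a] is one of the at most [D] children of its parent and is not yet embedded, so a unit of
   capacity is left. *)
have cpa : 0 < c (phi (par a)).
  have := gd2 _ pl; have := ch (par a); rewrite /= ar eqxx /=.
  by rewrite /childcount; move: (c _) (count _ _) => u v; clear; lia.
have Fl : #|[set x in map phi l]| < n.
  by rewrite cardsE; apply: leq_ltn_trans (card_size _) _; rewrite size_map.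
have [y [yF Ry gy]] := good_step cD Fl gd1 (phiU _ pl) cpa.
pose phi' b := if b == a then y else phi b.
have phi'l : {in l, phi' =1 phi}.
  by move=> b bl; rewrite /phi'; case: eqP bl al => // -> ->.
have yl b : b \in l -> phi b != y.
  by move=> bl; apply: contra yF => /eqP<-; rewrite inE map_f.
have map_phi' : map phi' l = map phi l by apply/eq_in_map.
have phi'a : phi' a = y by rewrite /phi' eqxx.
exists phi', (fun z => if z == phi (par a) then (c z).-1 else c z); split.
- move=> b b'; rewrite !inE => /orP[/eqP->|bl] /orP[/eqP->|bl'] //.
  + by rewrite phi'a phi'l // => E; have := yl _ bl'; rewrite E eqxx.
  + by rewrite phi'a phi'l // => E; have := yl _ bl; rewrite E eqxx.
  + by rewrite !phi'l //; apply: phiI.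
- move=> b; rewrite inE => /orP[/eqP->|bl]; first by rewrite phi'a; apply: RU Ry.
  by rewrite phi'l //; apply: phiU.
- move=> b; rewrite inE => /orP[/eqP->|bl] br; first by rewrite phi'a phi'l.
  by rewrite !phi'l //; [apply: phiR | have [] := cl' _ bl br].
split=> [x|x|_].
- by case: ifP => _; [apply: leq_trans (leq_pred _) _|].
- rewrite [map _ _]/= map_phi' inE negb_or => /andP[_ xF].
  case: (eqVneq x _) => [E|_]; last exact: cF.
  by rewrite E map_f in xF.
split.
  rewrite [map _ _]/= map_phi' phi'a.
  suff -> : [set x in y :: map phi l] = y |: [set x in map phi l] by [].
  by apply/setP=> x; rewrite !inE.
move=> b; rewrite inE => /orP[/eqP->|bl].
  rewrite phi'a; case: (eqVneq y _) => [E|_].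
    by have := yl _ pl; rewrite -E eqxx.
  by rewrite cF ?leq_addr //; move: yF; rewrite inE.
rewrite phi'l // /childcount /= ar /= -/(childcount l b).
have := gd2 _ bl; case: (eqVneq (phi b) _) => [E|_ le].
  rewrite (phiI _ _ bl pl E) eqxx; move: cpa; clear.
  by move: (c _) (childcount _ _) => x y; lia.
by apply: leq_trans le _; rewrite leq_add2l leq_addl.
Qed.
End Tree.
End FriedmanPippenger.
End OutNeighbours.

Lemma card_parts (V : finType) (Z : {set V}) (p : V -> nat) m :
  {in Z, forall x, p x < m} ->
  #|Z| = \sum_(i < m) #|[set x in Z | p x == i]|.
Proof.
case: m => [|m] pm.
  rewrite big_ord0; apply/eqP; rewrite cards_eq0 -subset0.
  by apply/subsetP=> x /pm.
rewrite -sum1_card (partition_big (fun x => inord (p x) : 'I_m.+1) xpredT) //=.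
apply: eq_bigr => i _; rewrite -sum1_card; apply: eq_bigl => x; rewrite inE.
by case: (boolP (x \in Z)) => //= xZ; rewrite -val_eqE /= inordK // pm.
Qed.

Section TreeEmbedding.
Variables (V : finType) (T : eqType) (r : T) (par : T -> T) (rank : T -> nat).
Variables (l : seq T) (D n : nat).
Hypotheses (rank0 : rank r = 0) (ul : uniq l) (cl : par_closed r par rank l).
Hypotheses (ch : forall a, childcount r par l a <= D) (sl : size l <= n).

(* The vertices violating expansion are discarded by removing a maximal set [Z]
   with [|outn Z :\: Z| <= (D + 1) |Z|]. *)
Lemma tree_embed (R : rel V) (U : {set V}) (K : nat) :
  (forall Z : {set V}, Z \subset U -> K < #|Z| -> #|Z| <= K + n.*2 ->
    D.+1 * #|Z| < #|(outn R Z :&: U) :\: Z|) -> K < #|U| ->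
  exists phi : T -> V, [/\ {in l &, injective phi}, {in l, forall a, phi a \in U} &
    {in l, forall a, a != r -> R (phi (par a)) (phi a)}].
Proof.
move=> expU KU.
pose P (Z : {set V}) := [&& Z \subset U, #|Z| <= K &
  #|(outn R Z :&: U) :\: Z| <= D.+1 * #|Z|].
have P0 : P set0.
  rewrite /P sub0set cards0 /= muln0 setD0 leqn0 cards_eq0; apply/eqP/setP=> y.
  by rewrite in_setI in_set0; case: outnP => // -[x]; rewrite inE.
have [Z /and3P[ZU ZK eZ] maxZ] :
    exists2 Z, P Z & forall Z', P Z' -> #|Z'| <= #|Z|.
  by case: (@arg_maxnP _ set0 P (fun Z => #|Z|) P0) => Z PZ mZ; exists Z.
pose W := U :\: Z; pose R' := [rel x y | R x y && (y \in W)].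
have outR' X : outn R' X = outn R X :&: W.
  apply/setP=> y; rewrite in_setI; apply/outnP/andP.
    by case=> x xX /andP[xy yW]; split=> //; apply/outnP; exists x.
  by case=> /outnP[x xX xy] yW; exists x => //; apply/andP.
(* If [X] failed to expand in [W], then [Z :|: X] would satisfy the inequality in [P]. With at most
   [K] elements this contradicts the maximality of [Z], otherwise it contradicts [expU]. *)
have expW (X : {set V}) : X \subset W -> #|X| <= n.*2 -> D.+1 * #|X| <= #|outn R' X|.
  move=> XW Xn; rewrite leqNgt; apply/negP => bad.
  have ZX : #|Z :|: X| = #|Z| + #|X|.
    rewrite cardsU (_ : Z :&: X = set0) ?cards0 ?subn0 //.
    by apply: disjoint_setI0; rewrite disjoint_sym; move: XW; rewrite subsetD => /andP[].
  have X0 : 0 < #|X| by case: #|X| bad => //; rewrite muln0.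
  have XU : X \subset U by apply: subset_trans XW (subsetDl _ _).
  have ZXU : Z :|: X \subset U by rewrite subUset ZU.
  have eZX : #|(outn R (Z :|: X) :&: U) :\: (Z :|: X)| <= D.+1 * #|Z :|: X|.
    rewrite ZX mulnDr; apply: leq_trans (leq_add eZ (ltnW bad)).
    apply: leq_trans (leq_card_setU _ _).1; apply: subset_leq_card.
    rewrite outnU outR'; apply/subsetP=> y; rewrite !(in_setD, in_setU, in_setI).
    by case: (y \in Z); case: (y \in X); case: (y \in U); rewrite ?andbF ?andbT.
  have := expU _ ZXU; have := maxZ (Z :|: X); rewrite /P ZXU eZX andbT /=.
  by move=> h1 h2; have := h2 ltac:(lia) ltac:(lia); lia.
have [|[x0 x0W]] := set_0Vmem W.
  by move=> /eqP; rewrite setD_eq0 => /subset_leq_card UZ; exfalso; lia.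
pose srt := sort (fun a b => rank b <= rank a) l.
have ml : srt =i l by apply/perm_mem/permEl/perm_sort.
have [||||a||phi [pI pU pR]] :=
  @embed_sorted V R' W D n expW T r par rank x0 srt rank0 x0W.
- by move=> x y /andP[].
- by apply: sort_sorted => a b; exact: leq_total.
- by rewrite sort_uniq.
- by move=> a; rewrite ml => al ar; rewrite ml; exact: cl.
- by rewrite /childcount (permP (permEl (perm_sort _ l))); exact: ch.
- by rewrite size_sort.
exists phi; split=> [a b al bl|a al|a al ar].
- by apply: pI; rewrite ml.
- by have := pU a; rewrite ml => /(_ al); rewrite inE => /andP[].
- by have := pR a; rewrite ml => /(_ al ar)/andP[].
Qed.

(** A set [Z] of more than [m * mu] vertices has [mu] of them in one part, and these reach or [Z]
    contains all but fewer than [mu] vertices of the next part. That part has at least [L] vertices,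
    so [Z] expands enough for [tree_embed] with [K = m * mu]. *)
Lemma cyclic_embed (E : rel V) (p : V -> nat) (U : {set V}) (m mu L : nat) :
  0 < m -> 0 < mu -> (forall x, x \in U -> p x < m) ->
  (forall i, i < m -> L <= #|[set x in U | p x == i]|) ->
  D.+2 * (m * mu + n.*2) + mu <= L ->
  (forall i (A B : {set V}), i < m ->
    A \subset [set x in U | p x == i] ->
    B \subset [set x in U | p x == i.+1 %% m] ->
    mu <= #|A| -> mu <= #|B| -> exists x y, [/\ x \in A, y \in B & E x y]) ->
  exists phi : T -> V, [/\ {in l &, injective phi}, {in l, forall a, phi a \in U} &
    {in l, forall a, a != r ->
      E (phi (par a)) (phi a) /\ p (phi a) = (p (phi (par a))).+1 %% m}].
Proof.
move=> m0 mu0 pm sizeL bigL edgeE.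
pose R := [rel x y | E x y && (p y == (p x).+1 %% m)].
have [Z ZU KZ Zn||phi [pI pU pR]] := @tree_embed R U (m * mu).
- have [i im Zi] : exists2 i, i < m & mu <= #|[set x in Z | p x == i]|.
    apply: contrapT => none.
    suff : #|Z| <= m * mu by lia.
    have -> : #|Z| = \sum_(i < m) #|[set x in Z | p x == i]|.
      by apply: card_parts => x /(subsetP ZU); exact: pm.
    rewrite -[X in X * mu]card_ord -sum_nat_const; apply: leq_sum => i _.
    rewrite leqNgt; apply/negP => lt; apply: none; exists i => //; exact: ltnW.
  set S := (_ :&: U) :\: Z.
  pose j := i.+1 %% m; pose B := [set x in U | p x == j] :\: (outn R Z :|: Z).
  have Bmu : #|B| < mu.
    rewrite ltnNge; apply/negP => Bmu.
    have [||x [y [xA yB xy]]] :=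
      edgeE i [set x in Z | p x == i] B im _ _ Zi Bmu.
    - by apply/subsetP=> x; rewrite !inE => /andP[/(subsetP ZU)-> ->].
    - exact: subsetDl.
    move: xA yB; rewrite !inE negb_or => /andP[xZ /eqP px] /andP[/andP[/negP ne _]].
    by move=> /andP[_ pj]; apply/ne/existsP; exists x; rewrite xZ /= xy px pj.
  have := sizeL j (ltn_pmod _ m0).
  have : #|[set x in U | p x == j]| <= #|B| + (#|Z| + #|S|).
    apply: leq_trans (leq_add (leqnn _) (leq_card_setU _ _).1).
    apply: leq_trans (leq_card_setU _ _).1; apply: subset_leq_card.
    apply/subsetP=> y yj; rewrite /B /S !(in_setD, in_setU, in_setI) yj.
    move: yj; rewrite inE => /andP[-> _].
    by case: (y \in Z); case: (y \in outn R Z).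
  have : D.+2 * #|Z| <= D.+2 * (m * mu + n.*2) by rewrite leq_mul2l Zn orbT.
  by rewrite !mulSn; lia.
- have : #|[set x in U | p x == 0]| <= #|U|.
    by apply: subset_leq_card; apply/subsetP=> x; rewrite inE => /andP[].
  have := sizeL 0 m0.
  have : m * mu + n.*2 <= D.+2 * (m * mu + n.*2) by rewrite leq_pmull.
  by lia.
exists phi; split=> // a al ar; have /andP[h1 /eqP h2] := pR a al ar.
by split.
Qed.
End TreeEmbedding.

(** * Transversals and expanders *)

Lemma card_bigcup_seq (T : Type) (I : finType) (s : seq T) (P : pred T)
    (B : T -> {set I}) k : all (fun b => P b ==> (#|B b| <= k)) s ->
  #|\bigcup_(b <- s | P b) B b| <= count P s * k.
Proof.
elim: s => [|b s IHs] /=; first by rewrite big_nil cards0.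
case/andP=> hb /IHs le; rewrite big_cons; case: (P b) hb => //= hb.
by apply: leq_trans (leq_card_setU _ _).1 _; rewrite mulSn leq_add.
Qed.

Section Transversal.
Variables (T : eqType) (I : finType) (near : rel T) (blue : T -> T -> rel I).
Variables (w F : nat).

(** The number of values wanted at a node with [r] neighbours still to be treated. The base leaves a
    value outside [F] sets of size [w]; the recursion leaves [w] values after deleting [w] sets of
    size at most [candidates r']. *)
Fixpoint candidates r := if r is r'.+1 then w * candidates r' + w else (F * w).+1.

Hypotheses (w0 : 0 < w) (nearC : symmetric near).
Hypothesis (blueC : forall a b i j, blue a b i j = blue b a j i).

Lemma candidates_big r : F * w < candidates r.
Proof.
elim: r => //= r IHr; apply: leq_trans IHr _.
by apply: leq_trans (leq_addr _ _); rewrite leq_pmull.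
Qed.

Lemma candidates_leq k r : k <= r -> candidates k <= candidates r.
Proof.
have step q : candidates q <= candidates q.+1.
  by apply: leq_trans (leq_addr _ _); rewrite leq_pmull.
by apply: (homo_leq leqnn leq_trans step).
Qed.

(* Greedy: fixing the value [z] at [a] restricts each neighbour [b] of [a] to the
   values that are not blue to [z]; fewer than [w] values [z] restrict a given
   [b] by a factor larger than [w], as otherwise [w] of them would leave [w]
   values at [b] that are blue to all of them. *)
Lemma independent_transversal (i0 : I) (l : seq T) (C : T -> {set I}) :
  {in l &, forall a b, near a b -> forall A B : {set I},
    A \subset C a -> B \subset C b -> w <= #|A| -> w <= #|B| ->
    exists i j, [/\ i \in A, j \in B & ~~ blue a b i j]} ->
  uniq l -> {in l, forall a, near a a = false} -> {in l, forall a, count (near a) l <= F} ->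
  {in l, forall a, candidates (count (near a) l) <= #|C a|} ->
  exists g : T -> I, {in l, forall a, g a \in C a} /\
    {in l &, forall a b, near a b -> ~~ blue a b (g a) (g b)}.
Proof.
elim: l C => [|a l IHl] C nK ul nearI nF big; first by exists (fun _ => i0).
have [al ul'] := andP ul.
pose red z b := [set j in C b | ~~ blue a b z j].
pose cand b := candidates (count (near b) l).
pose bad b := [set z in C a | #|red z b| < cand b].
have bad_small b : b \in l -> near a b -> #|bad b| <= w.
  move=> bl ab; apply/ltnW; rewrite ltnNge; apply/negP => /card_geqP[s [us ss sb]].
  pose B := C b :\: \bigcup_(z <- s) red z b.
  have redS : #|\bigcup_(z <- s) red z b| <= w * cand b.
    rewrite -ss -count_predT; apply: card_bigcup_seq; apply/allP=> z /sb.
    by rewrite inE => /andP[_ /ltnW].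
  have Bw : w <= #|B|.
    have bal : b \in a :: l by rewrite inE bl orbT.
    have := big b bal; rewrite /= nearC ab /= -/(cand b).
    have := cardsID (\bigcup_(z <- s) red z b) (C b); rewrite -/B.
    have := subset_leq_card (subsetIr (C b) (\bigcup_(z <- s) red z b)).
    move: redS; move: #|_ :&: _| #|B| #|C b| #|\bigcup_(z <- s) _| (w * cand b).
    by clear; lia.
  have [||||i [j [iA jB nb]]] :=
    nK a b (mem_head _ _) _ ab [set z in s] B _ _ _ Bw.
  - by rewrite inE bl orbT.
  - by apply/subsetP=> z; rewrite inE => /sb; rewrite inE => /andP[].
  - exact: subsetDl.
  - by rewrite cardsE; move/card_uniqP: us => ->; rewrite ss.
  move: jB; rewrite inE => /andP[/negP jn jC]; apply: jn.
  move: iA; rewrite inE => iA; rewrite (big_rem i iA) /= inE.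
  by rewrite inE jC nb.
have [z zC zgood] : exists2 z, z \in C a &
    {in l, forall b, near a b -> cand b <= #|red z b|}.
  have badU : #|\bigcup_(b <- l | near a b) bad b| <= F * w.
    apply: leq_trans (_ : count (near a) l * w <= _).
      by apply: card_bigcup_seq; apply/allP => b bl; apply/implyP; exact: bad_small.
    rewrite leq_mul2r orbC; have := nF a (mem_head _ _).
    by rewrite /= nearI ?mem_head // => ->.
  have /subsetPn[z zC zn] : ~~ (C a \subset \bigcup_(b <- l | near a b) bad b).
    apply/negP => /subset_leq_card le.
    have := leq_trans (big a (mem_head _ _)) (leq_trans le badU).
    by rewrite leqNgt candidates_big.
  exists z => // b bl ab; rewrite leqNgt; apply: contra zn => lt.
  by rewrite (big_rem b bl) /= ab inE inE zC lt.
pose C' b := if near a b then red z b else C b.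
have C'C b : C' b \subset C b.
  by rewrite /C'; case: ifP => // _; apply/subsetP=> j; rewrite inE => /andP[].
have [||||g [gC gb]] := IHl C' _ ul'.
- move=> b b' bl bl' bb' A B AC BC; apply: nK => //.
  + by rewrite inE bl orbT.
  + by rewrite inE bl' orbT.
  + exact: subset_trans AC (C'C _).
  + exact: subset_trans BC (C'C _).
- by move=> b bl; apply: nearI; rewrite inE bl orbT.
- move=> b bl; have := nF b; rewrite inE bl orbT => /(_ isT).
  by apply: leq_trans; rewrite /= leq_addl.
- move=> b bl; rewrite /C'; case: ifP => [|ab]; first exact: zgood.
  have := big b; rewrite inE bl orbT => /(_ isT).
  by rewrite /= nearC ab.
have g'l b : b \in l -> (if b == a then z else g b) = g b.
  by move=> bl; case: eqP bl al => // -> ->.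
exists (fun b => if b == a then z else g b); split=> [b|b b'].
  rewrite inE => /orP[/eqP->|bl]; first by rewrite eqxx.
  by rewrite g'l //; apply: (subsetP (C'C b)); exact: gC.
rewrite !inE => /orP[/eqP->|bl] /orP[/eqP->|bl'].
- by rewrite nearI ?mem_head.
- rewrite eqxx g'l // => ab; have := gC _ bl'; rewrite /C' ab inE.
  by case/andP.
- rewrite eqxx g'l // nearC => ab; have := gC _ bl; rewrite /C' ab inE blueC.
  by case/andP.
- by rewrite !g'l //; exact: gb.
Qed.
End Transversal.

(** By Bernoulli's inequality [a.+1 ^ a] is at least [2 * a ^ a], so the exponent [a * q] gains a
    factor [2 ^ q > q]. *)
Lemma pow_gap a q : 0 < a -> exists e, q * a ^ e < a.+1 ^ e.
Proof.
move=> a0; exists (a * q).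
have ber k : a ^ k * (a + k) <= a * a.+1 ^ k.
  elim: k => [|k IHk]; first by rewrite !expn0 addn0 muln1 mul1n.
  rewrite !expnS; move: IHk; move: (a ^ k) (a.+1 ^ k) => u v; nia.
have two : 2 * a ^ a <= a.+1 ^ a.
  by have := ber a; rewrite -(leq_pmul2l a0); move: (a ^ a) (a.+1 ^ a); nia.
rewrite !expnM; apply: leq_trans (_ : (2 * a ^ a) ^ q <= _); last first.
  by case: (q) => // q'; rewrite leq_exp2r.
have lt : q < 2 ^ q by exact: ltn_expl.
have pos : 0 < (a ^ a) ^ q by rewrite !expn_gt0 a0.
by rewrite expnMn ltn_pmul2r.
Qed.

(** Counts the bad families in [expander_ex]. A family of [#|I|] maps is one function on [I * J],
    whose values are independent choices. *)
Lemma card_avoiding (I J : finType) (A B : {set J}) :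
  #|[set f : {ffun I * J -> J} | [forall p, (p.2 \in A) ==> (f p \notin B)]]| =
  (#|J| - #|B|) ^ (#|I| * #|A|) * #|J| ^ (#|I| * (#|J| - #|A|)).
Proof.
pose S (p : I * J) : pred J := [pred y | (p.2 \in A) ==> (y \notin B)].
have -> : #|[set f : {ffun I * J -> J} | [forall p, (p.2 \in A) ==> (f p \notin B)]]| =
    #|family S|.
  rewrite cardsE; apply: eq_card => f; rewrite [LHS]unfold_in.
  by apply/forallP/familyP => h p; have := h p; rewrite ?inE.
rewrite card_family foldrE big_map big_enum /= (bigID [pred p : I * J | p.2 \in A]) /=.
have cardA (A' : {set J}) : #|[pred p : I * J | p.2 \in A']| = #|I| * #|A'|.
  rewrite -cardsT -cardsX; apply: eq_card => p; by rewrite !inE.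
congr (_ * _).
  rewrite (eq_bigr (fun _ => #|J| - #|B|)) ?prod_nat_const ?cardA // => p pA.
  by rewrite -(cardsC B) addKn; apply: eq_card => y; rewrite !inE pA.
rewrite (eq_bigr (fun _ => #|J|)) ?prod_nat_const => [|p /negPf pA].
  by rewrite -(cardsC A) addKn -(cardA (~: A)); congr (_ ^ _);
    apply: eq_card => p; rewrite !inE.
by apply: eq_card => y; rewrite !inE pA.
Qed.

(** Union bound over pairs of [n]-sets. With [q = a.+1] and [N = q * n] there are at most [4 ^ N]
    pairs, and a proportion [(a / a.+1) ^ (e * n)] of the families of [e] maps is bad for a given
    pair. [pow_gap] gives [4 ^ a.+1 * a ^ e < a.+1 ^ e], whose [n]-th power is the required
    bound. *)
Lemma expander_ex q : 1 < q -> exists Delta, forall n, 0 < n ->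
  exists f : 'I_Delta -> 'I_(q * n) -> 'I_(q * n),
  forall A B : {set 'I_(q * n)}, n <= #|A| -> n <= #|B| ->
    exists i x, x \in A /\ f i x \in B.
Proof.
case: q => // a a0; have [e gap] := pow_gap (4 ^ a.+1) a0.
exists e => n n0; set N := a.+1 * n; set V := 'I_N.
pose bad (p : {set V} * {set V}) :=
  [set f : {ffun 'I_e * V -> V} | [forall x, (x.2 \in p.1) ==> (f x \notin p.2)]].
pose P := [pred p : {set V} * {set V} | (#|p.1| == n) && (#|p.2| == n)].
have sub (A : {set V}) : n <= #|A| -> exists2 A' : {set V}, A' \subset A & #|A'| = n.
  case/card_geqP=> s [us ss sA]; exists [set x in s].
    by apply/subsetP=> x; rewrite inE => /sA.
  by rewrite cardsE; move/card_uniqP: us => ->.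
have [f fgood] : exists f, forall p, P p -> f \notin bad p.
  apply: contrapT => none.
  pose k := (N - n) ^ (e * n) * N ^ (e * (N - n)).
  have badk p : P p -> #|bad p| <= k.
    by case/andP=> /eqP p1 /eqP p2; rewrite card_avoiding p1 p2 !card_ord.
  have covered : #|[set: {ffun 'I_e * V -> V}]| <=
      #|\bigcup_(p <- enum {: {set V} * {set V}} | P p) bad p|.
    apply: subset_leq_card; apply/subsetP=> f _; apply: contrapT => /negP fn.
    apply: none; exists f => p Pp; apply: contra fn => fp.
    rewrite (big_rem p) ?mem_enum // [X in if X then _ else _]Pp.
    by rewrite in_setU fp.
  have : N ^ (e * N) <= 2 ^ N * 2 ^ N * k.
    move: covered; rewrite cardsT card_ffun card_prod !card_ord => le.
    apply: leq_trans le _.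
    apply: leq_trans (_ : count P (enum {: {set V} * {set V}}) * k <= _).
      by apply: card_bigcup_seq; apply/allP=> p _; apply/implyP; exact: badk.
    rewrite leq_mul2r; apply/orP; right; apply: leq_trans (count_size _ _) _.
    by rewrite -cardE card_prod -!cardsT -powersetT card_powerset cardsT card_ord.
  rewrite leqNgt => /negP; apply.
  have nN : n <= N by rewrite leq_pmull.
  have -> : e * N = e * n + e * (N - n) by rewrite -mulnDr subnKC.
  rewrite expnD mulnA ltn_pmul2r ?expn_gt0 ?muln_gt0 ?n0 //.
  have -> : N - n = a * n by rewrite /N mulSn addKn.
  rewrite -expnMn (_ : 2 * 2 = 4) // /N (expnM 4) !(expnM _ e) -expnMn ltn_exp2r //.
  by rewrite !expnMn mulnA ltn_pmul2r ?gap // expn_gt0 n0.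
exists (fun i x => f (i, x)) => A B /sub[A' A'A cA] /sub[B' B'B cB].
have := fgood (A', B'); rewrite /P /= cA cB eqxx => /(_ isT).
rewrite inE => /forallPn[[i x] /=]; rewrite negb_imply negbK => /andP[xA fB].
by exists i, x; rewrite (subsetP A'A) ?(subsetP B'B).
Qed.

(** * Clique separators of chordal graphs *)

Lemma next_cat_cons (T : eqType) (c1 c2 : seq T) u v :
  uniq (c1 ++ u :: v :: c2) -> next (c1 ++ u :: v :: c2) u = v.
Proof.
rewrite next_nth mem_cat mem_head orbT cat_uniq /= negb_or => /and3P[_ /andP[u1 _] _].
case: c1 u1 => [|y c1] /=; first by rewrite eqxx.
rewrite inE negb_or => /andP[/negPf uy u1]; rewrite eq_sym uy index_cat (negPf u1) /= eqxx.
by rewrite addn0 nth_cat ltnNge leqnSn subSnn.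
Qed.

Lemma next_last (T : eqType) (c : seq T) x v :
  uniq (x :: rcons c v) -> next (x :: rcons c v) v = x.
Proof.
rewrite next_nth inE mem_rcons mem_head orbT /= mem_rcons inE negb_or rcons_uniq.
case/andP=> /andP[/negPf-> _] /andP[vc _].
by rewrite -cats1 index_cat (negPf vc) /= eqxx addn0 nth_default // size_cat addn1.
Qed.

(** A cycle of length at least four through the edge [x y] has a chord, which cuts off a part not
    containing this edge. Shortening in this way ends with a triangle on [x y], whose third vertex
    lies on the original cycle. *)
Lemma chordal_triangle (G : sgraph) (x y : G) (p : seq G) : chordal G ->
  sedge x y -> path (@sedge G) y p -> p != [::] -> sedge (last y p) x ->
  uniq (x :: y :: p) -> exists z, [/\ z \in p, sedge x z & sedge y z].
Proof.
move=> chG; have [n] := ubnP (size p); elim: n p => // n IHn p szp xy yp p0 lx uc.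
case: (leqP 2 (size p)) => sz; last first.
  case: p p0 sz yp lx {szp uc IHn} => // a [|//] _ _ /= /andP[ya _] ax.
  by exists a; rewrite mem_head sedge_sym.
have cyc : cycle (@sedge G) (x :: y :: p) by rewrite /= rcons_path yp xy.
(* [u] is the end of the chord that comes first from [x] on. The shorter cycle drops [c3] if [u] is
   [x] and [c2] otherwise; the conditions on [next] make the dropped part nonempty. *)
have key u v c1 c2 c3 : x :: y :: p = c1 ++ u :: c2 ++ v :: c3 -> sedge u v ->
    v != next (x :: y :: p) u -> u != next (x :: y :: p) v ->
    exists z, [/\ z \in p, sedge x z & sedge y z].
  move=> Ec uv vn un.
  have shorter p' : subseq p' p -> size p' < size p -> path (@sedge G) y p' ->
      p' != [::] -> sedge (last y p') x ->
      exists z, [/\ z \in p, sedge x z & sedge y z].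
    move=> pp lt yp' p'0 lx'.
    have [||z [zp xz yz]] := IHn p' _ xy yp' p'0 lx'; first exact: leq_trans lt szp.
      by apply: subseq_uniq uc; rewrite /= !eqxx.
    by exists z; rewrite (mem_subseq pp).
  have {}vn : c2 != [::].
    apply: contraNneq vn => c20; move: uc; rewrite Ec c20 /= => uc.
    by rewrite next_cat_cons.
  case: c1 Ec => [|x' c1] /= [xu].
    case: c2 vn => // y' c2 _ [yy' Ep].
    have {}un : c3 != [::].
      apply: contraNneq un => c30; rewrite Ep c30 cats1 -rcons_cons next_last ?xu //.
      by rewrite rcons_cons -cats1 -c30 -Ep -xu.
    rewrite -xu sedge_sym in uv.
    apply: (shorter (rcons c2 v)).
    - by rewrite Ep -cat_rcons prefix_subseq.
    - by rewrite Ep size_cat size_rcons /=; case: (c3) un => //= *; lia.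
    - by move: yp; rewrite Ep -cat_rcons cat_path => /andP[].
    - by case: (c2).
    - by rewrite last_rcons.
  have c2s : 0 < size c2 by case: (c2) vn.
  case: c1 => [|y' c1] /= [yu Ep].
    apply: (shorter (v :: c3)).
    - by rewrite Ep suffix_subseq.
    - by rewrite Ep size_cat /=; lia.
    - by move: yp; rewrite Ep cat_path /= yu uv => /and3P[].
    - by [].
    - by move: lx; rewrite Ep last_cat.
  apply: (shorter (c1 ++ u :: v :: c3)).
  - by rewrite Ep cat_subseq //= eqxx suffix_subseq.
  - by rewrite Ep !size_cat /= size_cat /=; lia.
  - by move: yp; rewrite Ep !cat_path /= cat_path /= uv => /and5P[-> -> _ _ ->].
  - by case: (c1).
  - by move: lx; rewrite Ep !last_cat /= last_cat.
have split_at (s : seq G) u : u \in s -> exists s1 s2, s = s1 ++ u :: s2.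
  by case/splitPr=> s1 s2; exists s1, s2.
have [u [v [uc' vc uv vn un]]] := chG _ cyc uc sz.
have [c1 [c2 Ec]] := split_at _ _ uc'.
move: vc; rewrite Ec mem_cat inE => /or3P[/split_at[s1 [s2 E1]]|/eqP E1|].
- rewrite sedge_sym in uv; apply: (key v u s1 s2 c2) => //.
  by rewrite Ec E1 -catA.
- by rewrite E1 sedge_irrefl in uv.
- by case/split_at=> s1 [s2 E1]; apply: (key u v c1 s1 s2) => //; rewrite Ec E1.
Qed.

Section CliqueSeparators.
Variables (V : finType) (e : rel V).
Hypothesis eC : symmetric e.
Hypothesis triangle : forall x y p, e x y -> path e y p -> p != [::] ->
  e (last y p) x -> uniq (x :: y :: p) -> exists z, [/\ z \in p, e x z & e y z].
Implicit Types (P Q K N W Y A B : {set V}).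

Definition within W := [rel x y | [&& e x y, x \in W & y \in W]].

Definition comp W x := [set y | connect (within W) x y].

Lemma within_sym W : symmetric (within W).
Proof. by move=> x y; rewrite /= eC [(y \in W) && _]andbC. Qed.

Lemma comp_refl W x : x \in comp W x.
Proof. by rewrite inE connect0. Qed.

Lemma comp_closed W x y z : x \in W -> y \in comp W x -> e y z -> z \in W -> z \in comp W x.
Proof.
rewrite !inE => xW xy yz zW; apply: connect_trans (xy) _; apply: connect1.
rewrite /= yz zW andbT; case/connectP: xy => p xp ->.
by case/lastP: p xp => [|p t] //=; rewrite rcons_path last_rcons => /andP[_ /and3P[]].
Qed.

Lemma comp_sub W x : x \in W -> comp W x \subset W.
Proof.
move=> xW; apply/subsetP=> y; rewrite inE => /connectP[p xp ->].
by case/lastP: p xp => [|p t] //=; rewrite rcons_path last_rcons => /andP[_ /and3P[]].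
Qed.

Lemma connect_closed W K x y : x \in K -> connect (within W) x y ->
  (forall s t, s \in K -> e s t -> t \in W -> t \in K) ->
  connect (within (W :&: K)) x y /\ y \in K.
Proof.
move=> xK /connectP[p xp ->] cl {y}; elim: p x xK xp => [|t p IHp] x xK //=.
case/andP=> /and3P[xt xW tW] tp; have tK := cl _ _ xK xt tW.
have [h1 h2] := IHp _ tK tp; split=> //; apply: connect_trans h1; apply: connect1.
by rewrite /= xt !inE xW xK tW.
Qed.

(** Take [v] in [K] with the most neighbours in [N]. If it misses [x], follow a path in [K] from [v]
    to the first vertex [t] adjacent to [x]. For each neighbour [y] of [v] in [N] the path closes up
    through [x y] to a cycle, and the triangle on [x y] must have third vertex [t]. So [t] sees [x]
    and all of [N] that [v] sees, against maximality. *)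
Lemma dominating_vertex K N : K != set0 ->
  {in K &, forall x y, connect (within K) x y} -> [disjoint N & K] ->
  {in N &, forall x y, x != y -> e x y} ->
  {in N, forall x, exists2 z, z \in K & e x z} ->
  exists2 v, v \in K & {in N, forall x, e v x}.
Proof.
case/set0Pn=> v0 v0K conK dis clN nbr.
have notK x : x \in N -> x \in K = false by move=> xN; exact: disjointFr dis xN.
case: (@arg_maxnP _ v0 (mem K) (fun v => #|[set y in N | e v y]|) v0K) => v vK maxv.
exists v => // x xN; apply: contrapT => /negP nvx.
have [z zK xz] := nbr x xN.
case/connectP: (conK v z vK zK) => p0 /shortenP[p vp up _] Ez.
have hasx : has (e x) (v :: p) by apply/hasP; exists z; rewrite // Ez mem_last.
have pK : {subset v :: p <= K}.
  move: vp vK; clear; elim: p v => [|t p IHp] v /= => [_|/andP[/and3P[_ _ tK] tp]] vK s.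
    by rewrite inE => /eqP->.
  by rewrite inE => /orP[/eqP->//|]; apply: IHp.
have vpe : path e v p by apply: sub_path vp => s t /and3P[].
have [t [s1 [s2 [Ep xt ns1]]]] : exists t s1 s2,
    [/\ v :: p = rcons s1 t ++ s2, e x t & ~~ has (e x) s1].
  by case: (split_find hasx) => t s1 s2 xt ns1; exists t, s1, s2.
case: s1 Ep ns1 => [[vt _]|v' s1 [<-{v'} Ep]] /=.
  by move: nvx; rewrite eC vt xt.
rewrite negb_or => /andP[xv ns1].
have tK : t \in K by apply: pK; rewrite Ep !inE mem_cat mem_rcons mem_head orbT.
suff : #|[set y in N | e v y]| < #|[set y in N | e t y]|.
  by rewrite ltnNge => /negP; apply; exact: maxv.
apply: proper_card; apply/properP; split; last first.
  by exists x; rewrite inE xN ?(eC t) ?xt //=.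
apply/subsetP=> y; rewrite !inE => /andP[yN vy]; rewrite yN /=.
have yx : x != y by apply: contraNneq nvx => ->.
have [|||||z' [z'p xz' yz']] := @triangle x y (v :: rcons s1 t).
- exact: clN.
- rewrite /= eC vy; move: vpe; rewrite Ep cat_path; by case/andP.
- by [].
- by rewrite /= last_rcons eC.
- rewrite cons_uniq inE negb_or yx; apply/and3P; split.
  + by apply/negP => xp; have := notK x xN; rewrite pK // Ep -cat_cons mem_cat xp.
  + by apply/negP => yp; have := notK y yN; rewrite pK // Ep -cat_cons mem_cat yp.
  + by move: up; rewrite Ep -cat_cons cat_uniq => /andP[].
move: z'p; rewrite inE mem_rcons inE => /or3P[/eqP z'v|/eqP <-|z's].
- by rewrite -z'v xz' in xv.
- by rewrite eC.
- by case/hasP: ns1; exists z'.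
Qed.

(** Otherwise each clique [Q] leaves a component [K] with more than half of [Y]. Keep the set [N] of
    vertices of [Q] with a neighbour in [K] and add a vertex [v] of [K] dominating [N]. The heavy
    component left by this new clique meets [K], hence lies in [K :\ v], and heavy components would
    shrink forever. *)
Lemma clique_separator P Y : exists Q, [/\ Q \subset P,
  {in Q &, forall x y, x != y -> e x y} &
  {in P :\: Q, forall x, (#|Y :&: comp (P :\: Q) x|).*2 <= #|Y|}].
Proof.
apply: contrapT => none.
have heavy Q : Q \subset P -> {in Q &, forall x y, x != y -> e x y} ->
    exists2 x, x \in P :\: Q & #|Y| < (#|Y :&: comp (P :\: Q) x|).*2.
  move=> QP cQ; apply: contrapT => no; apply: none; exists Q; split=> // x xW.
  by rewrite leqNgt; apply/negP => lt; apply: no; exists x.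
suff descent k Q x : Q \subset P -> {in Q &, forall x y, x != y -> e x y} ->
    x \in P :\: Q -> #|Y| < (#|Y :&: comp (P :\: Q) x|).*2 ->
    #|comp (P :\: Q) x| < k -> False.
  have [||x xW hx] := @heavy set0; first exact: sub0set.
    by move=> x y; rewrite inE.
  apply: (descent _ set0 x _ _ xW hx (ltnSn _)); first exact: sub0set.
  by move=> y z; rewrite inE.
elim: k Q x => // k IHk Q x QP cQ xW hx; set W := P :\: Q in xW hx *.
set K := comp W x; rewrite ltnS => Kk.
pose N := [set z in Q | [exists y in K, e z y]].
have KW : K \subset W := comp_sub xW.
have NQ : N \subset Q by apply/subsetP=> z; rewrite inE => /andP[].
have [|||||v vK vN] := @dominating_vertex K N.
- by apply/set0Pn; exists x; exact: comp_refl.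
- move=> y z yK zK; have yz : connect (within W) y z.
    move: yK zK; rewrite !inE => xy; apply: connect_trans.
    by rewrite (sym_connect_sym (@within_sym W)).
  have [|] := connect_closed yK yz.
    by move=> s t sK st tW; exact: comp_closed sK st tW.
  by rewrite (setIidPr KW).
- rewrite disjoints_subset; apply: subset_trans NQ _; rewrite -disjoints_subset.
  by rewrite disjoint_sym disjoints_subset; apply: subset_trans KW (subsetDr _ _).
- by move=> y z /(subsetP NQ) yQ /(subsetP NQ) zQ; exact: cQ.
- by move=> y; rewrite inE => /andP[_ /existsP[z /andP[zK yz]]]; exists z.
have vW := subsetP KW v vK.
pose Q' := v |: N.
have Q'P : Q' \subset P.
  rewrite subUset sub1set (subset_trans NQ QP) andbT.
  by move: vW; rewrite inE => /andP[].
have cQ' : {in Q' &, forall x y, x != y -> e x y}.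
  move=> y z; rewrite !in_setU1 => /orP[/eqP->|yN] /orP[/eqP->|zN].
  - by rewrite eqxx.
  - by move=> _; exact: vN.
  - by move=> _; rewrite eC; exact: vN.
  - by apply: cQ; apply: (subsetP NQ).
have [x' x'W hx'] := heavy Q' Q'P cQ'.
apply: (IHk Q' x' Q'P cQ' x'W hx').
set K' := comp _ x' in hx' *.
have [t tK tK'] : exists2 t, t \in K & t \in K'.
  have /set0Pn[t] : (Y :&: K) :&: (Y :&: K') != set0.
    rewrite -card_gt0; have := cardsUI (Y :&: K) (Y :&: K').
    have : #|(Y :&: K) :|: (Y :&: K')| <= #|Y|.
      by apply: subset_leq_card; rewrite subUset !subsetIl.
    move: hx hx'; rewrite -/K; move: #|_ :|: _| #|_ :&: (_ :&: _)| #|Y :&: K| #|Y :&: K'| #|Y|.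
    by clear; lia.
  by rewrite !inE => /andP[/andP[_ h1] /andP[_ h2]]; exists t; rewrite inE.
have sub : K' \subset K :\ v.
  apply/subsetP=> y yK'; rewrite in_setD1; apply/andP; split.
    apply: contraTneq (subsetP (comp_sub x'W) y yK') => ->.
    by rewrite !inE eqxx.
  have ty : connect (within (P :\: Q')) t y.
    move: tK' yK'; rewrite !inE => xt; apply: connect_trans.
    by rewrite (sym_connect_sym (@within_sym _)).
  have [|//] := connect_closed tK ty.
  move=> s u sK su; rewrite in_setD => /andP[uQ' uP].
  apply: (comp_closed xW sK su); rewrite in_setD uP andbT.
  apply: contra uQ' => uQ; rewrite in_setU1 inE uQ /=; apply/orP; right.
  by apply/existsP; exists s; rewrite sK eC.
apply: leq_trans Kk; rewrite (cardsD1 v K) vK add1n ltnS.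
exact: subset_leq_card sub.
Qed.

(** Take a union [A] of components with [#|Y :&: A|] maximal subject to at most two thirds of [Y].
    If the rest is too heavy, [A] has less than a third, and by maximality another component [K]
    meeting [Y] has more than a third. It has at most half, so [K] can replace [A]. *)
Lemma balanced_separator P Y : exists Q A, [/\ Q \subset P,
  {in Q &, forall x y, x != y -> e x y}, A \subset P :\: Q,
  {in A, forall x, {in P :\: Q, forall y, e x y -> y \in A}} &
  3 * #|Y :&: A| <= 2 * #|Y| /\ 3 * #|Y :&: ((P :\: Q) :\: A)| <= 2 * #|Y|].
Proof.
have [Q [QP cQ half]] := clique_separator P Y; set W := P :\: Q in half.
pose closed A := (A \subset W) &&
  [forall x in A, forall y in W, e x y ==> (y \in A)].
have closedP A : reflect (A \subset W /\
    {in A, forall x, {in W, forall y, e x y -> y \in A}}) (closed A).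
  apply: (iffP andP) => -[AW h]; split=> //.
    move=> x xA y yW xy; have /forallP/(_ x)/implyP/(_ xA) := h.
    by move=> /forallP/(_ y); rewrite yW xy.
  apply/forallP=> x; apply/implyP=> xA; apply/forallP=> y; apply/implyP=> yW.
  by apply/implyP; exact: h.
suff [A [/closedP[AW cA] h1 h2]] : exists A, [/\ closed A,
    3 * #|Y :&: A| <= 2 * #|Y| & 3 * #|Y :&: (W :\: A)| <= 2 * #|Y|].
  by exists Q, A; split.
have P0 : closed set0 && (3 * #|Y :&: set0| <= 2 * #|Y|).
  rewrite setI0 cards0 muln0 andbT; apply/closedP.
  by split; [exact: sub0set | move=> x; rewrite inE].
case: (@arg_maxnP _ set0 (fun A => closed A && (3 * #|Y :&: A| <= 2 * #|Y|))
  (fun A => #|Y :&: A|) P0) => A /andP[cA leA] maxA.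
case: (leqP (3 * #|Y :&: (W :\: A)|) (2 * #|Y|)) => [leB|gtB].
  by exists A.
have [x] : exists x, x \in Y :&: (W :\: A).
  by apply/set0Pn; rewrite -card_gt0; case: #|_ :&: _| gtB => //; rewrite muln0.
rewrite in_setI in_setD => /and3P[xY xA xW].
set K := comp W x.
have cK : closed K.
  apply/closedP; split; first exact: comp_sub.
  by move=> y yK z zW yz; exact: comp_closed yK yz zW.
have /closedP[KW _] := cK; have /closedP[AW clA] := cA.
have cAK : closed (A :|: K).
  apply/closedP; split; first by rewrite subUset AW KW.
  move=> y yAK z zW yz; move: yAK; rewrite !in_setU => /orP[yA|yK].
    by rewrite (clA _ yA _ zW yz).
  by rewrite (comp_closed xW yK yz zW) orbT.
exists K; split=> //; have hK := half x xW; rewrite -/K in hK; first by lia.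
have bigAK : 2 * #|Y| < 3 * #|Y :&: (A :|: K)|.
  rewrite ltnNge; apply/negP => le; have := maxA (A :|: K).
  rewrite cAK le => /(_ isT) /=; rewrite leqNgt => /negP; apply.
  apply: proper_card; apply/properP; split; first by rewrite setIS // subsetUl.
  by exists x; rewrite !inE ?connect0 ?orbT ?xY // (negPf xA).
have hU : #|Y :&: (A :|: K)| <= #|Y :&: A| + #|Y :&: K|.
  by rewrite setIUr (leq_card_setU _ _).1.
have hA : #|Y :&: A| + #|Y :&: (W :\: A)| <= #|Y|.
  rewrite -(cardsID A Y) leq_add2l subset_leq_card //; apply/subsetP=> y.
  by rewrite !inE => /and3P[-> -> _].
have hKK : #|Y :&: K| + #|Y :&: (W :\: K)| <= #|Y|.
  rewrite -(cardsID K Y) leq_add2l subset_leq_card //; apply/subsetP=> y.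
  by rewrite !inE => /and3P[-> -> _].
move: gtB bigAK hU hA hKK; move: #|Y :&: (A :|: K)| #|Y :&: A| #|Y :&: K|.
move: #|Y :&: (W :\: K)| #|Y :&: (W :\: A)| #|Y|; clear; lia.
Qed.
End CliqueSeparators.

(** * Tree partitions *)

Section TreePartition.
Variables (V : finType) (h : rel V) (d kappa : nat).
Hypotheses (hC : symmetric h) (hd : forall x, #|[set y | h x y]| <= d).
Hypothesis separator : forall P Y : {set V}, exists Q A : {set V},
  [/\ Q \subset P, #|Q| <= kappa, A \subset P :\: Q,
  {in A, forall x, {in P :\: Q, forall y, h x y -> y \in A}} &
  3 * #|Y :&: A| <= 2 * #|Y| /\ 3 * #|Y :&: ((P :\: Q) :\: A)| <= 2 * #|Y|].
Implicit Types (P Q S Y A : {set V}).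

Lemma card_outn Q : #|outn h Q| <= #|Q| * d.
Proof.
have -> : outn h Q = \bigcup_(x <- enum Q | true) [set y | h x y].
  apply/setP=> y; rewrite big_enum; apply/outnP/bigcupP.
    by case=> x xQ xy; exists x; rewrite ?inE.
  by case=> x xQ; rewrite inE => xy; exists x.
rewrite (cardE (mem Q)) -(count_predT (enum (mem Q))); apply: card_bigcup_seq.
by apply/allP=> x _; exact: hd.
Qed.

(** Positive, so that a single vertex is an admissible [S] in [tree_partition]. *)
Definition piece := (3 * d * kappa).+1.

(* As long as [|Y| > 3 d kappa], the neighbours of a separator add less to [Y]
   than the separation removes from it on either side. *)
Lemma split_pieces m P Y : #|Y| <= m -> exists Q (rho : V -> nat),
  [/\ Q \subset P, #|Q| <= kappa * (2 ^ m).-1,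
    {in P :\: Q, forall x, rho x < 2 ^ m},
    {in P :\: Q &, forall x y, h x y -> rho x = rho y} &
    forall i, #|[set x in P :\: Q | (rho x == i) && (x \in Y :|: outn h Q)]| <= piece].
Proof.
elim: m P Y => [|m IHm] P Y Ym; last case: (leqP #|Y| piece) => Yp.
- exists set0, (fun _ => 0); split=> //; rewrite ?sub0set ?cards0 ?expn_gt0 //.
  move=> i; have -> : Y :|: outn h set0 = set0.
    have -> : Y = set0 by apply/eqP; rewrite -cards_eq0 -leqn0.
    apply/setP=> x; rewrite set0U in_set0; apply/negP => /outnP[y].
    by rewrite inE.
  apply: leq_trans (_ : #|@set0 V| <= _); last by rewrite cards0.
  by apply: subset_leq_card; apply/subsetP=> x; rewrite !inE !andbF.
- exists set0, (fun _ => 0); split=> //; rewrite ?sub0set ?cards0 ?expn_gt0 //.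
  move=> i; apply: leq_trans Yp; apply: subset_leq_card; apply/subsetP=> x.
  rewrite in_set => /and3P[_ _]; rewrite in_setU => /orP[//|/outnP[y]].
  by rewrite inE.
have [Q0 [A [Q0P Q0k AW clA [YA YB]]]] := separator P Y.
set B := (P :\: Q0) :\: A in YB.
have clB : {in B, forall x, {in P :\: Q0, forall y, h x y -> y \in B}}.
  move=> x; rewrite in_setD => /andP[xA xW] y yW xy; rewrite in_setD yW andbT.
  by apply: contra xA => yA; apply: (clA y yA x xW); rewrite hC.
have BW : B \subset P :\: Q0 by exact: subsetDl.
have dk : #|outn h Q0| <= d * kappa.
  by apply: leq_trans (card_outn Q0) _; rewrite mulnC leq_mul2l Q0k orbT.
have small X : 3 * #|Y :&: X| <= 2 * #|Y| -> #|(Y :|: outn h Q0) :&: X| <= m.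
  move=> YX; rewrite setIUl.
  have := (leq_card_setU (Y :&: X) (outn h Q0 :&: X)).1.
  have := subset_leq_card (subsetIl (outn h Q0) X).
  move: Yp dk YX Ym; rewrite /piece -mulnA; move: (d * kappa) #|_ :|: _| #|outn h Q0|.
  by move: #|_ :&: X| #|_ :&: X| #|Y|; clear; lia.
have [QA [rhoA [QAA QAk rA hA pA]]] := IHm A _ (small _ YA).
have [QB [rhoB [QBB QBk rB hB pB]]] := IHm B _ (small _ YB).
pose Q := Q0 :|: (QA :|: QB).
have AB x : x \in A -> x \in B -> False by rewrite in_setD => -> /andP[].
have inW x : x \in P :\: Q -> x \in P :\: Q0.
  by rewrite /Q !in_setD !in_setU !negb_or => /andP[/andP[-> _] ->].
have inA x : x \in P :\: Q -> x \in A -> x \in A :\: QA.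
  by rewrite /Q !in_setD !in_setU !negb_or => /andP[/and3P[_ -> _] _] ->.
have inB x : x \in P :\: Q -> x \notin A -> x \in B :\: QB.
  move=> xW xA; rewrite in_setD [x \in B]in_setD xA (inW x xW) !andbT.
  by move: xW; rewrite /Q !in_setD !in_setU !negb_or => /andP[/and3P[_ _ ->]].
(* Labels on the side [B] are shifted past those of [A]. Neighbours of [QB] do not occur in [A], nor
   those of [QA] in [B], as no edge joins the two sides. *)
exists Q, (fun x => if x \in A then rhoA x else 2 ^ m + rhoB x); split.
- rewrite !subUset Q0P (subset_trans QAA) ?(subset_trans QBB) //.
    exact: subset_trans BW (subsetDl _ _).
  exact: subset_trans AW (subsetDl _ _).
- have := (leq_card_setU Q0 (QA :|: QB)).1; have := (leq_card_setU QA QB).1.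
  have : 0 < 2 ^ m by rewrite expn_gt0.
  move: Q0k QAk QBk; rewrite -/Q expnS; move: (2 ^ m) #|Q| #|_ :|: _| #|Q0| #|QA| #|QB|.
  clear; move=> k a b c a' b'; case: k => // k; rewrite mul2n doubleS /= -addnn.
  nia.
- move=> x xW; rewrite expnS mul2n -addnn; case: ifP => xA.
    by apply: leq_trans (rA x (inA x xW xA)) _; rewrite leq_addr.
  by rewrite ltn_add2l rB // inB // xA.
- move=> x y xW yW xy; case: ifP => xA; case: ifP => yA.
  + by apply: hA xy; apply: inA.
  + by rewrite (clA x xA y (inW y yW) xy) in yA.
  + by rewrite (clA y yA x (inW x xW)) // hC in xA.
  + by congr (_ + _); apply: hB xy; apply: inB; rewrite ?xA ?yA.
move=> i; case: (ltnP i (2 ^ m)) => im.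
- apply: leq_trans (pA i); apply: subset_leq_card; apply/subsetP=> x.
  rewrite in_set => /and3P[xW]; case: ifP => xA; last first.
    by move=> /eqP Ei; move: im; rewrite -Ei ltnNge leq_addr.
  move=> ri xYQ; rewrite in_set ri (inA x xW xA) /=.
  rewrite !in_setU in_setI xA andbT in_setU.
  move: xYQ; rewrite in_setU => /orP[->//|]; rewrite !outnU !in_setU.
  case/or3P=> [->|->|/outnP[z zQB zx]]; rewrite ?orbT //.
  case: (AB x xA); apply: (clB z _ x (inW x xW) zx); exact: (subsetP QBB).
- apply: leq_trans (pB (i - 2 ^ m)); apply: subset_leq_card; apply/subsetP=> x.
  rewrite in_set => /and3P[xW]; case: ifP => xA.
    move=> /eqP Ei; move: im; rewrite -Ei leqNgt => /negP[].
    exact: rA (inA x xW xA).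
  move=> /eqP <- xYQ; have xB : x \in B :\: QB by rewrite inB // xA.
  rewrite in_set addKn eqxx xB /=.
  have {}xB : x \in B by move: xB; rewrite in_setD => /andP[].
  rewrite !in_setU in_setI xB andbT in_setU.
  move: xYQ; rewrite in_setU => /orP[->//|]; rewrite !outnU !in_setU.
  case/or3P=> [->|/outnP[z zQA zx]|->]; rewrite ?orbT //.
  case: (AB x) => //; apply: (clA z _ x (inW x xW) zx); exact: (subsetP QAA).
Qed.

Definition adjacent_addr (u v : seq nat) :=
  [\/ u = v, exists i, v = rcons u i | exists i, u = rcons v i].

Lemma adjacent_addr_cons i u v :
  adjacent_addr u v -> adjacent_addr (i :: u) (i :: v).
Proof.
by case=> [->|[j ->]|[j ->]]; [constructor 1|constructor 2; exists j|constructor 3; exists j].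
Qed.

(* A tree partition: the nodes of the tree are words, and the parent of a word is
   obtained by deleting its last letter. *)
Definition layout P (D w : nat) (addr : V -> seq nat) :=
  [/\ {in P, forall x, all (ltn^~ D) (addr x)},
    {in P &, forall x y, h x y -> adjacent_addr (addr x) (addr y)},
    forall u, #|[set x in P | addr x == u]| <= w &
    {in P, forall x u i, addr x = rcons u i -> exists2 y, y \in P & addr y = u}].

(** [split_pieces] is applied to the neighbours of at most [piece] vertices, hence with
    [m = piece * d]. *)
Definition branching := 2 ^ (piece * d).
Definition bag := piece + kappa * branching.

(** The root bag is [S :|: Q], where [Q] splits the rest so that each piece has at most [piece]
    vertices in [outn h S :|: outn h Q]. These must lie in the bag just below the root, so they are
    the set [S] of the recursive call for the piece. *)
Lemma tree_partition P S : S \subset P -> #|S| <= piece -> (P != set0 -> S != set0) ->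
  exists addr, layout P branching bag addr /\ {in S, forall x, addr x = [::]}.
Proof.
have [n] := ubnP #|P|; elim: n P S => // n IHn P S Pn SP Sp S0.
have [P0|Pne] := eqVneq P set0.
  exists (fun _ => [::]); split=> //; rewrite P0; split.
  - by move=> x; rewrite inE.
  - by move=> x y; rewrite inE.
  - move=> u; rewrite (_ : [set x in _ | _] = set0) ?cards0 //.
    by apply/setP=> x; rewrite !inE.
  - by move=> x; rewrite inE.
have {S0} /set0Pn[x0 x0S] := S0 Pne.
have Ym : #|outn h S| <= piece * d.
  by apply: leq_trans (card_outn S) _; rewrite leq_mul2r Sp orbT.
have [Q [rho [QP Qk rho_lt hrho small]]] := split_pieces (P :\: S) Ym.
pose W := (P :\: S) :\: Q; pose R := S :|: Q.
have WR x : x \in P -> (x \in W) = (x \notin R).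
  by move=> xP; rewrite /W /R !in_setD in_setU negb_or xP andbT andbC.
pose part i := [set x in W | rho x == i].
have WP : W \subset P by apply: subset_trans (subsetDl _ _) (subsetDl _ _).
have partP i : part i \subset P.
  by apply/subsetP=> x; rewrite in_set => /andP[/(subsetP WP)].
have /choice[sub subP] : forall i, exists addr, layout (part i) branching bag addr /\
    {in part i :&: outn h R, forall x, addr x = [::]}.
  move=> i; have part_n : #|part i| < n.
    rewrite -ltnS; apply: leq_trans Pn; rewrite ltnS; apply: proper_card.
    apply/properP; split=> //; exists x0; first exact: (subsetP SP).
    by rewrite !inE x0S /= andbF.
  have [E|ne] := eqVneq (part i :&: outn h R) set0; last first.
    apply: IHn => //; first exact: subsetIl.
    apply: leq_trans (small i); apply: subset_leq_card; apply/subsetP=> x.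
    rewrite in_setI outnU => /andP[xi xR]; rewrite in_set xR andbT.
    by move: xi; rewrite in_set.
  (* A piece without neighbours in the root bag may start from any of its vertices; its top bag has
     to be nonempty, since prefixes of used words must be used. *)
  have [T [TP Tp T0]] : exists T : {set V},
      [/\ T \subset part i, #|T| <= piece & part i != set0 -> T != set0].
    have [->|/set0Pn[x xi]] := eqVneq (part i) set0.
      by exists set0; rewrite sub0set cards0 eqxx.
    exists [set x]; rewrite sub1set xi cards1; split=> // _.
    by apply/set0Pn; exists x; rewrite inE.
  have [addr [la _]] := IHn (part i) T part_n TP Tp T0.
  by exists addr; split=> // x; rewrite E inE.
pose addr x := if x \in R then [::] else rho x :: sub (rho x) x.
have in_part x : x \in P -> x \notin R -> x \in part (rho x).
  by move=> xP xR; rewrite in_set eqxx WR // xR.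
exists addr; split; last by move=> x xS; rewrite /addr in_setU xS.
split.
- move=> x xP; rewrite /addr; case: ifPn => // xR /=.
  have [[letters _ _ _] _] := subP (rho x); rewrite letters ?in_part // andbT.
  by apply: rho_lt; rewrite -/W WR.
- have down x y : x \in P -> y \in P -> h x y -> x \in R -> y \notin R ->
      addr y = rcons (addr x) (rho y).
    move=> xP yP xy xR yR; rewrite /addr xR (negPf yR) /=.
    have [_ ->] := subP (rho y) => //; rewrite in_setI in_part //=.
    by apply/outnP; exists x.
  move=> x y xP yP xy; case: (boolP (x \in R)) => xR; case: (boolP (y \in R)) => yR.
  + by constructor 1; rewrite /addr xR yR.
  + by constructor 2; exists (rho y); apply: down.
  + by constructor 3; exists (rho x); apply: down => //; rewrite hC.
  rewrite /addr (negPf xR) (negPf yR).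
  have Er : rho x = rho y by apply: hrho xy; rewrite -/W WR.
  rewrite -Er; apply: adjacent_addr_cons.
  have [[_ hsub _ _] _] := subP (rho x); apply: hsub xy; rewrite ?in_part //.
  by rewrite Er in_part.
- case=> [|i u].
    apply: leq_trans (_ : #|R| <= _).
      apply: subset_leq_card; apply/subsetP=> x; rewrite inE /addr => /andP[_].
      by case: ifP.
    apply: leq_trans (leq_card_setU _ _).1 _; rewrite /bag leq_add //.
    by apply: leq_trans Qk _; rewrite leq_mul2l leq_pred orbT.
  have [[_ _ card_sub _] _] := subP i; apply: leq_trans (card_sub u).
  apply: subset_leq_card; apply/subsetP=> x; rewrite inE /addr => /andP[xP].
  case: ifPn => // xR /eqP[<- <-].
  by rewrite in_set in_part // eqxx.
move=> x xP u i; rewrite /addr; case: ifPn => [_|xR]; first by case: u.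
case: u => [_|j u [Ej Eu]].
  by exists x0; rewrite ?(subsetP SP) // in_setU x0S.
have [[_ _ _ closed_sub] _] := subP j.
have [||y yj Ey] := closed_sub x _ u i; [by rewrite -Ej in_part | by rewrite -Ej |].
move: (yj); rewrite in_set => /andP[yW /eqP rj].
have yP := subsetP WP y yW; exists y => //.
by rewrite ifN -?WR // rj Ey.
Qed.
End TreePartition.

(** * Passing to parts without blue bicliques *)

Definition part (V : finType) (p : V -> nat) (U : {set V}) i := [set x in U | p x == i].

Lemma split_in_parts (V : finType) (U : {set V}) m K : m * K <= #|U| ->
  exists p : V -> nat, forall i, i < m -> K <= #|part p U i|.
Proof.
elim: m U => [|m IHm] U; first by exists (fun _ => 0).
rewrite mulSn => le; have /card_geqP[s [us ss sU]] : K <= #|U| by lia.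
have [|p pK] := IHm (U :\: [set x in s]).
  have := cardsID [set x in s] U; have : #|U :&: [set x in s]| <= K.
    rewrite -ss; apply: leq_trans (card_size s); apply: subset_leq_card.
    by apply/subsetP=> x; rewrite !inE => /andP[].
  by move: le; move: #|_ :&: _| #|_ :\: _| #|U| (m * K); clear; lia.
exists (fun x => if x \in s then m else p x) => i; rewrite ltnS leq_eqVlt.
case/orP=> [/eqP->|im].
  rewrite -ss -(card_uniqP us); apply: subset_leq_card; apply/subsetP=> x xs.
  by rewrite inE (sU x xs) xs eqxx.
apply: leq_trans (pK i im) _; apply: subset_leq_card; apply/subsetP=> x.
by rewrite !inE => /andP[/andP[/negPf-> ->] ->].
Qed.

Lemma pigeonhole (V J : finType) (k : V -> J) q : 0 < #|J| -> #|J| * q <= #|V| ->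
  exists j, q <= #|[set x | k x == j]|.
Proof.
move=> J0 le; apply: contrapT => none.
have small j : #|[set x | k x == j]| < q.
  by rewrite ltnNge; apply/negP => h; apply: none; exists j.
case: q le none small => [|q] le none small; first by case/card_gt0P: J0 => j; have := small j.
have : #|V| <= #|J| * q.
  rewrite -sum1_card (partition_big k xpredT) //= -sum_nat_const.
  by apply: leq_sum => j _; have := small j; rewrite ltnS -sum1_card;
    under eq_bigl do rewrite inE.
by move: le J0; rewrite mulnS; move: (#|J| * q) #|V| #|J|; clear; lia.
Qed.

Section Shrinking.
Variables (V : finType) (T : eqType) (r : T) (par : T -> T) (rank : T -> nat).
Variables (l : seq T) (D n : nat).
Hypotheses (rank0 : rank r = 0) (ul : uniq l) (cl : par_closed r par rank l).
Hypotheses (ch : forall a, childcount r par l a <= D) (sl : size l <= n).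

(** [E] need not be symmetric: it is read from a vertex of [X] to a vertex outside [X], whichever of
    the two is the image of the parent. *)
Definition bipartite_copy (E : rel V) (U : {set V}) :=
  exists (X : {set V}) (phi : T -> V), [/\ {in l &, injective phi},
    {in l, forall a, phi a \in U} & {in l, forall a, a != r ->
      if phi (par a) \in X then (phi a \notin X) && E (phi (par a)) (phi a)
      else (phi a \in X) && E (phi a) (phi (par a))}].

(** The size needed by [cyclic_embed] for two parts, in units of [mu]: [D.+2 * (2 * mu + n.*2) + mu
    <= shrink * mu] when [n <= mu]. *)
Definition shrink := D.+2 * 4 + 1.

Variable p : V -> nat.

(** If no such [X] and [Y] exist, any two [mu]-subsets of the two parts span an edge, and
    [cyclic_embed] with two parts places the tree alternately in them. *)
Lemma shrink_pair (E : rel V) (U : {set V}) i j mu : i != j -> 0 < mu -> n <= mu ->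
  shrink * mu <= #|part p U i| -> shrink * mu <= #|part p U j| ->
  bipartite_copy E U \/
  exists X Y : {set V}, [/\ X \subset part p U i, Y \subset part p U j,
    mu <= #|X|, mu <= #|Y| & {in X & Y, forall x y, ~~ E x y}].
Proof.
move=> ij mu0 nmu Xi Yj.
have [copy|no] := pselect (bipartite_copy E U); [by left | right].
apply: contrapT => dense; apply: no.
set X := part p U i in Xi dense; set Y := part p U j in Yj dense.
have dis x : x \in X -> x \in Y -> False.
  by rewrite !inE => /andP[_ /eqP->] /andP[_ /eqP E2]; rewrite E2 eqxx in ij.
pose E' x y := if x \in X then E x y else E y x.
have edge (A B : {set V}) : A \subset X -> B \subset Y -> mu <= #|A| -> mu <= #|B| ->
    exists x y, [/\ x \in A, y \in B & E x y].
  move=> AX BY Amu Bmu; apply: contrapT => none; apply: dense; exists A, B; split=> //.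
  by move=> x y xA yB; apply/negP => xy; apply: none; exists x, y.
have q0 : [set x in X :|: Y | (x \in Y : nat) == 0] = X.
  apply/setP=> x; rewrite in_set in_setU; case: (boolP (x \in Y)) => xY.
    by rewrite andbF; apply/esym/negP => xX; exact: dis xX xY.
  by rewrite orbF andbT.
have q1 : [set x in X :|: Y | (x \in Y : nat) == 1] = Y.
  by apply/setP=> x; rewrite in_set in_setU; case: (x \in Y); rewrite ?orbT ?andbF.
have [|k k2||k A B k2|phi [pI pU pE]] := @cyclic_embed V T r par rank l D n rank0 ul cl ch sl
  E' (fun x => x \in Y) (X :|: Y) 2 mu (shrink * mu) isT mu0.
- by move=> x _; case: (x \in Y).
- by case: k k2 => [|[|//]] _; rewrite ?q0 ?q1.
- by rewrite /shrink; move: nmu; clear; nia.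
- case: k k2 => [|[|//]] _.
    rewrite [1 %% 2]/= q0 q1 => AX BY Amu Bmu.
    have [x [y [xA yB xy]]] := edge A B AX BY Amu Bmu.
    by exists x, y; split=> //; rewrite /E' (subsetP AX).
  rewrite [2 %% 2]/= q0 q1 => AY BX Amu Bmu.
  have [x [y [xB yA xy]]] := edge B A BX AY Bmu Amu; exists y, x; split=> //.
  by rewrite /E' ifN //; apply/negP => /dis; apply; exact: (subsetP AY).
exists X, phi; split=> // [a al|a al ar].
  by have := pU a al; rewrite in_setU => /orP[]; rewrite inE => /andP[].
have [pl _] := cl al ar; have [] := pE a al ar; rewrite /E'.
have in_XY b : b \in l -> (phi b \in X) = (phi b \notin Y).
  move=> bl; have := pU b bl; rewrite in_setU => /orP[bX|bY].
    by rewrite bX; apply/esym/negP; exact: dis.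
  by rewrite bY; apply/negP => /dis; apply.
rewrite !in_XY //; case: (phi (par a) \in Y); case: (phi a \in Y) => //=.
Qed.

Lemma bipartite_copyS (E : rel V) (U U' : {set V}) :
  U' \subset U -> bipartite_copy E U' -> bipartite_copy E U.
Proof.
move=> /subsetP U'U [X [phi [pI pU pE]]]; exists X, phi; split=> // a al.
exact/U'U/pU.
Qed.

(** One use of [shrink_pair] per entry of [ts]. It costs a factor [shrink] in the two parts
    concerned, and a pair once free of edges stays so in subsets. *)
Lemma shrink_all (Tau : eqType) (E : Tau -> rel V) m (ts : seq (nat * nat * Tau))
    (U : {set V}) mu : 0 < mu -> n <= mu ->
  {in ts, forall t, [/\ t.1.1 != t.1.2, t.1.1 < m & t.1.2 < m]} ->
  (forall i, i < m -> shrink ^ size ts * mu <= #|part p U i|) ->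
  (exists2 t, t \in ts & bipartite_copy (E t.2) U) \/
  exists U' : {set V}, [/\ U' \subset U, forall i, i < m -> mu <= #|part p U' i| &
    {in ts, forall t, {in part p U' t.1.1 & part p U' t.1.2, forall x y, ~~ E t.2 x y}}].
Proof.
move=> mu0 nmu; elim: ts U => [|[[i j] tau] ts IHts] U ok big.
  by right; exists U; split=> // i im; have := big i im; rewrite mul1n.
have [/= ij im jm] := ok _ (mem_head _ _).
have shrink0 : 0 < shrink by rewrite /shrink addn1.
pose nu := shrink ^ size ts * mu.
have mu_nu : mu <= nu by rewrite leq_pmull // expn_gt0 shrink0.
have big' k : k < m -> shrink * nu <= #|part p U k|.
  by move=> km; have := big k km; rewrite /= expnS -mulnA.
have [copy|[X [Y [XU YU Xnu Ynu XY]]]] := shrink_pair (E tau) ij (leq_trans mu0 mu_nu)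
  (leq_trans nmu mu_nu) (big' i im) (big' j jm).
  by left; exists (i, j, tau); rewrite ?mem_head.
pose U1 := (U :\: (part p U i :|: part p U j)) :|: (X :|: Y).
have pX x : x \in X -> (x \in U) && (p x == i).
  by move=> /(subsetP XU); rewrite inE.
have pY x : x \in Y -> (x \in U) && (p x == j).
  by move=> /(subsetP YU); rewrite inE.
have U1U : U1 \subset U.
  apply/subsetP=> x; rewrite !in_setU in_setD => /orP[/andP[]//|].
  by case/orP=> [/pX|/pY] /andP[].
have [|k km|[t tts copy]|[U' [U'U1 U'big noE]]] := IHts U1.
- by move=> t tts; apply: ok; rewrite inE tts orbT.
- case: (eqVneq k i) => [->|ki].
    apply: leq_trans Xnu _; apply: subset_leq_card; apply/subsetP=> x xX.
    by have /andP[_ px] := pX x xX; rewrite in_set px !in_setU xX orbT.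
  case: (eqVneq k j) => [->|kj].
    apply: leq_trans Ynu _; apply: subset_leq_card; apply/subsetP=> x xY.
    by have /andP[_ px] := pY x xY; rewrite in_set px !in_setU xY !orbT.
  apply: leq_trans (_ : #|part p U k| <= _).
    by apply: leq_trans (big' k km); rewrite leq_pmull.
  apply: subset_leq_card; apply/subsetP=> x; rewrite in_set => /andP[xU /eqP px].
  by rewrite in_set !(in_setU, in_setD) !in_set px xU eqxx (negPf ki) (negPf kj).
- left; exists t; first by rewrite inE tts orbT.
  exact: bipartite_copyS copy.
right; exists U'; split=> //; first exact: subset_trans U'U1 U1U.
move=> t; rewrite inE => /orP[/eqP->|/noE//] /= x y.
rewrite !in_set => /andP[/(subsetP U'U1) xU1 /eqP px] /andP[/(subsetP U'U1) yU1 /eqP py].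
apply: XY.
- have xU := subsetP U1U x xU1; move: xU1; rewrite !(in_setU, in_setD) !in_set xU px eqxx /=.
  by case/orP=> // /pY /andP[_]; rewrite px (negPf ij).
- have yU := subsetP U1U y yU1; move: yU1.
  rewrite !(in_setU, in_setD) !in_set yU py eqxx orbT /=.
  by case/orP=> // /pX /andP[_]; rewrite py eq_sym (negPf ij).
Qed.
End Shrinking.

(** * Near nodes in a tree of bounded degree *)

Section Descendants.
Variables (T : eqType) (r : T) (par : T -> T) (rank : T -> nat) (l : seq T).
Hypotheses (rank0 : rank r = 0) (cl : par_closed r par rank l).
Hypothesis rank_par : {in l, forall a, a != r -> rank a = (rank (par a)).+1}.

(** The distance [k] from [b] up to [a] satisfies [0 < k < m]; the guard [k <= rank b] stops at the
    root, where [par] has no meaning. *)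
Definition descends m a b := has (fun k => (k <= rank b) && (iter k par b == a)) (iota 1 m.-1).
Definition near m a b := descends m a b || descends m b a.

Lemma near_sym m : symmetric (near m).
Proof. by move=> a b; rewrite /near orbC. Qed.

Lemma iter_par k b : b \in l -> k <= rank b ->
  iter k par b \in l /\ rank (iter k par b) = rank b - k.
Proof.
move=> bl; elim: k => [|k IHk] kb; first by rewrite subn0.
have [il ir] := IHk (ltnW kb).
have ne : iter k par b != r by apply: contraTneq kb => E; move: ir; rewrite E rank0; lia.
split; first by have [] := cl il ne.
by have := rank_par il ne; rewrite iterS ir; lia.
Qed.

Lemma near_irr m a : a \in l -> near m a a = false.
Proof.
move=> al; apply/negP; rewrite /near orbb => /hasP[k]; rewrite mem_iota.
case/andP=> k0 _ /andP[ka /eqP ia]; have [_] := iter_par al ka.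
by rewrite ia; lia.
Qed.
Variable D : nat.
Hypotheses (ul : uniq l) (ch : forall a, childcount r par l a <= D).

Lemma count_iter k a : count (fun b => (k <= rank b) && (iter k par b == a)) l <= D ^ k.
Proof.
elim: k => [|k IHk].
  by rewrite expn0 (eq_count (a2 := pred1 a)) // count_uniq_mem // leq_b1.
pose s := [seq c <- l | (k <= rank c) && (iter k par c == a)].
apply: leq_trans (_ : \sum_(c <- s) childcount r par l c <= _); last first.
  apply: leq_trans (_ : \sum_(c <- s) D <= _); first by apply: leq_sum => c _; exact: ch.
  rewrite big_const_seq count_predT iter_addn_0 size_filter expnS leq_mul2l.
  by rewrite IHk orbT.
have us : uniq s by exact: filter_uniq.
apply: leq_trans (_ : count (fun b => (b != r) && (par b \in s)) l <= _).
  rewrite -!size_filter; apply: uniq_leq_size; first exact: filter_uniq.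
  move=> b; rewrite !mem_filter => /andP[/andP[kb /eqP ib] bl]; rewrite bl andbT.
  have br : b != r by apply: contraTneq kb => ->; rewrite rank0.
  have [pl _] := cl bl br; have := rank_par bl br.
  by rewrite br /= pl andbT -iterSr ib eqxx andbT; lia.
elim: (s) us => [|c s' IHs] /=.
  by rewrite big_nil leqn0 (eq_count (a2 := pred0)) ?count_pred0 // => b; rewrite andbF.
case/andP=> cs' us'; rewrite big_cons; apply: leq_trans (leq_add (leqnn _) (IHs us')).
rewrite -[X in _ <= X]count_predUI; apply: leq_trans (leq_addr _ _).
apply: sub_count => b /= /andP[-> /=]; by rewrite inE orbC eq_sym.
Qed.

(** Fewer than [m] levels, each with at most [D ^ m] descendants and one ancestor. *)
Lemma count_near m a : 0 < D -> count (near m a) l <= m * (D ^ m + 1).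
Proof.
move=> D0; have hasU (f : nat -> pred T) (ks : seq nat) X :
    all (fun k => count (f k) l <= X) ks ->
    count (fun b => has (fun k => f k b) ks) l <= size ks * X.
  elim: ks => [|k ks IHks] /=; first by rewrite (eq_count (a2 := pred0)) ?count_pred0.
  case/andP=> hk /IHks le; rewrite mulSn; apply: leq_trans (leq_add hk le).
  by rewrite -count_predUI leq_addr.
apply: leq_trans (_ : m.-1 * D ^ m + m.-1 * 1 <= _); last first.
  by rewrite -mulnDr leq_mul2r leq_pred orbT.
apply: leq_trans (_ : count (descends m a) l + count (fun b => descends m b a) l <= _).
  by rewrite -count_predUI leq_addr.
apply: leq_add; rewrite -[X in X * _](size_iota 1).
  apply: hasU; apply/allP=> k; rewrite mem_iota => /andP[_ km].
  by apply: leq_trans (count_iter k a) _; rewrite leq_pexp2l //; lia.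
apply: hasU; apply/allP=> k _; case: (k <= rank a) => /=.
  by rewrite (eq_count (a2 := pred1 (iter k par a))) ?count_uniq_mem ?leq_b1.
by rewrite (eq_count (a2 := pred0)) ?count_pred0.
Qed.

End Descendants.

(** * The red copy *)

Section Balls.
Variables (V : finType) (Delta : nat) (f : 'I_Delta -> V -> V).

Fixpoint ball m x : {set V} :=
  if m is m'.+1 then ball m' x :|: \bigcup_(i <- enum 'I_Delta) ball m' (f i x)
  else [set x].

Lemma card_ball m x : #|ball m x| <= Delta.+1 ^ m.
Proof.
elim: m x => [|m IHm] x /=; first by rewrite cards1.
apply: leq_trans (leq_card_setU _ _).1 _; rewrite expnS mulSn leq_add //.
rewrite -[X in _ <= X * _](size_enum_ord Delta) -(count_predT (enum _)).
by apply: card_bigcup_seq; apply/allP=> i _; exact: IHm.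
Qed.

Lemma ball_leq k m x : k <= m -> ball k x \subset ball m x.
Proof.
move=> /subnKC <-; elim: (m - k) => [|j IHj]; first by rewrite addn0.
by rewrite addnS; apply: subset_trans IHj (subsetUl _ _).
Qed.

Lemma ball_step k x y i : y \in ball k x -> f i y \in ball k.+1 x.
Proof.
elim: k x => [|k IHk] x.
  move=> /set1P ->; rewrite in_setU (big_rem i) ?mem_enum //=.
  by rewrite !in_setU !in_set1 eqxx orbT.
rewrite in_setU => /orP[/IHk yx|]; first by rewrite in_setU yx.
rewrite big_enum => /bigcupP[j _ /IHk yj].
rewrite in_setU; apply/orP; right; rewrite big_enum.
by apply/bigcupP; exists j.
Qed.
End Balls.

Section RedCopy.
Variables (V I : finType) (Delta : nat) (f : 'I_Delta -> V -> V).
Variables (T : eqType) (r : T) (par : T -> T) (rank : T -> nat).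
Variables (l : seq T) (D n : nat).
Hypotheses (rank0 : rank r = 0) (ul : uniq l) (cl : par_closed r par rank l).
Hypothesis rank_par : {in l, forall a, a != r -> rank a = (rank (par a)).+1}.
Hypotheses (ch : forall a, childcount r par l a <= D) (sl : size l <= n).

Lemma iter_ball phi (p : V -> nat) m :
  {in l, forall a, a != r -> (exists i, phi a = f i (phi (par a))) /\
    p (phi a) = (p (phi (par a))).+1 %% m} ->
  {in l, forall b, p (phi b) < m} ->
  forall k b, b \in l -> k <= rank b -> phi b \in ball f k (phi (iter k par b)) /\
    p (phi b) = (p (phi (iter k par b)) + k) %% m.
Proof.
move=> step pm; elim=> [|k IHk] b bl kb.
  by rewrite inE eqxx addn0 modn_small ?pm.
have br : b != r by apply: contraTneq kb => ->; rewrite rank0.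
have [pl _] := cl bl br; have rb := rank_par bl br.
have [|h1 h2] := IHk (par b) pl; first by lia.
have [[i Ei] Ep] := step b bl br; rewrite iterSr; split.
  by rewrite Ei; apply: ball_step.
by rewrite Ep h2 -addn1 modnDml addn1 addnS.
Qed.

(** The part index advances by one modulo [m] along each tree edge, so near nodes land in different
    parts, and one lies in the ball of radius [m] around the other. Between different parts there is
    no blue biclique inside [S], and [independent_transversal] picks values with no blue pair at
    near nodes. *)
Lemma red_copy (i0 : I) (U : {set V}) (p : V -> nat) m w (S : {set I})
    (blue : rel (V * I)) : 0 < D -> 0 < m -> 0 < n -> 0 < w -> symmetric blue ->
  {in U, forall x, p x < m} ->
  (forall i, i < m -> (D.+2 * (m * n + n.*2) + n) <= #|part p U i|) ->
  (forall A B : {set V}, n <= #|A| -> n <= #|B| -> exists i x, x \in A /\ f i x \in B) ->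
  {in U &, forall x y, p x != p y -> forall A B : {set I}, A \subset S -> B \subset S ->
    w <= #|A| -> w <= #|B| -> exists i j, [/\ i \in A, j \in B & ~~ blue (x, i) (y, j)]} ->
  candidates w (m * (D ^ m + 1)) (m * (D ^ m + 1)) <= #|S| ->
  exists (phi : T -> V) (g : T -> I), {in l &, injective phi} /\
    {in l &, forall a b, near par rank m a b ->
      ((phi b \in ball f m (phi a)) || (phi a \in ball f m (phi b))) &&
      ~~ blue (phi a, g a) (phi b, g b)}.
Proof.
move=> D0 m0 n0 w0 blueC pm sizeU expand noK bigS.
pose E := [rel x y | [exists i, y == f i x]].
have [i A B im _ _ An Bn|phi [pI pU pE]] :=
  @cyclic_embed V T r par rank l D n rank0 ul cl ch sl E p U m n _ m0 n0 pm sizeU (leqnn _).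
- have [j [x [xA fB]]] := expand A B An Bn.
  by exists x, (f j x); split=> //; apply/existsP; exists j.
have pm' : {in l, forall b, p (phi b) < m} by move=> b bl; apply: pm; exact: pU.
have step : {in l, forall a, a != r -> (exists i, phi a = f i (phi (par a))) /\
    p (phi a) = (p (phi (par a))).+1 %% m}.
  by move=> a al ar; have [/existsP[i /eqP Ei] ?] := pE a al ar; split=> //; exists i.
have desc a b : b \in l -> descends par rank m a b ->
    phi b \in ball f m (phi a) /\ p (phi a) != p (phi b).
  move=> bl /hasP[k]; rewrite mem_iota => /andP[k0 km] /andP[kb /eqP <-].
  have [h1 h2] := iter_ball step pm' bl kb.
  have {}km : k < m by lia.
  split; first exact: subsetP (ball_leq _ _ (ltnW km)) _ h1.
  rewrite h2; have [il _] := iter_par rank0 cl rank_par bl kb.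
  have := pm' _ il; move: (p _) => q qm; apply/eqP => E1.
  case: (ltnP (q + k) m) => h; first by rewrite modn_small // in E1; lia.
  have : (q + k) %% m = q + k - m.
    by rewrite -{1}(subnK h) modnDr modn_small //; lia.
  by lia.
have nearP a b : a \in l -> b \in l -> near par rank m a b ->
    ((phi b \in ball f m (phi a)) || (phi a \in ball f m (phi b))) /\ p (phi a) != p (phi b).
  move=> al bl /orP[/(desc _ _ bl)[-> ->]//|/(desc _ _ al)[-> ne]].
  by rewrite orbT eq_sym.
have nb a : count (near par rank m a) l <= m * (D ^ m + 1).
  exact: (count_near rank0 cl rank_par ul ch).
have [||||a al|g [gS gb]] := @independent_transversal T I (near par rank m)
  (fun a b i j => blue (phi a, i) (phi b, j)) w (m * (D ^ m + 1)) w0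
  (@near_sym _ _ _ _) _ i0 l (fun _ => S) _ ul.
- by move=> a b i j; rewrite blueC.
- move=> a b al bl ab A B AS BS Aw Bw; have [_ ne] := nearP a b al bl ab.
  by apply: (noK _ _ (pU _ al) (pU _ bl) ne).
- by move=> a al; exact: (near_irr rank0 cl rank_par).
- by move=> a _; exact: nb.
- exact: leq_trans (candidates_leq _ w0 (nb a)) bigS.
exists phi, g; split=> // a b al bl ab; have [-> _] := nearP a b al bl ab.
exact: gb.
Qed.
End RedCopy.

(** * The tree of words with nodes replaced by paths *)

Section Words.
Definition wpar (u : seq nat) := take (size u).-1 u.

Lemma wpar_rcons u i : wpar (rcons u i) = u.
Proof. by rewrite /wpar size_rcons -cats1 take_size_cat. Qed.

Lemma size_wpar u : u != [::] -> size u = (size (wpar u)).+1.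
Proof. by case/lastP: u => // u i _; rewrite wpar_rcons size_rcons. Qed.

Variables (w : nat).

(* Every node [u] of the word tree is replaced by the path [(u, 0), ..., (u, w - 1)]. *)
Definition npar (a : seq nat * nat) :=
  if a.2 is j.+1 then (a.1, j) else (wpar a.1, w.-1).

Definition nrank (a : seq nat * nat) := size a.1 * w + a.2.

Definition nroot : seq nat * nat := ([::], 0).

Definition nodes (l : seq (seq nat)) := [seq (u, j) | u <- l, j <- iota 0 w].

Hypothesis w0 : 0 < w.

Lemma nrank_npar a : a != nroot -> nrank a = (nrank (npar a)).+1.
Proof.
case: a => u [|j] ne; rewrite /nrank /=; last by rewrite addnS.
have u0 : u != [::] by apply: contraNneq ne => ->.
by rewrite (size_wpar u0) mulSn -addnS prednK //; lia.
Qed.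

Lemma iter_npar k u j : iter k npar (u, j + k) = (u, j).
Proof. by elim: k => [|k IHk]; [rewrite addn0 | rewrite addnS iterSr]. Qed.

(** The source of the radius [2 * w]: the way down from [(u, j)] to [(rcons u i, k)] has
    [(w.-1 - j) + k.+1] steps, at most [2 * w - 1], and within one path it is shorter. *)
Lemma near_nodes u v j k : adjacent_addr u v -> j < w -> k < w -> (u, j) != (v, k) ->
  near npar nrank (2 * w) (u, j) (v, k).
Proof.
have same u' j' k' : j' < k' -> k' < w -> descends npar nrank (2 * w) (u', j') (u', k').
  move=> jk kw; apply/hasP; exists (k' - j'); first by rewrite mem_iota; lia.
  have -> : iter (k' - j') npar (u', k') = (u', j').
    by rewrite -{2}(subnKC (ltnW jk)) iter_npar.
  rewrite eqxx andbT /nrank /=.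
  by apply: leq_trans (leq_addl _ _); rewrite leq_subr.
have down u' i j' k' : j' < w -> k' < w ->
    descends npar nrank (2 * w) (u', j') (rcons u' i, k').
  move=> jw kw; apply/hasP; exists ((w.-1 - j') + k'.+1); first by rewrite mem_iota; lia.
  apply/andP; split; first by rewrite /nrank /= size_rcons mulSn; lia.
  have := iter_npar k' (rcons u' i) 0; rewrite add0n => E1.
  have := iter_npar (w.-1 - j') u' j'; rewrite subnKC ?iterD ?iterS ?E1; last by lia.
  by rewrite {3}/npar /= wpar_rcons => ->.
move=> uv jw kw ne; apply/orP; case: uv ne => [<-|[i ->]|[i ->]] ne.
- case: (ltngtP j k) => jk; [by left; apply: same | by right; apply: same |].
  by rewrite jk eqxx in ne.
- by left; apply: down.
- by right; apply: down.
Qed.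
Variables (D : nat) (l : seq (seq nat)).
Lemma mem_nodes u j : ((u, j) \in nodes l) = (u \in l) && (j < w).
Proof.
apply/allpairsP/andP => [[[u' j'] /= [ul' jl [-> ->]]]|[ul' jw]].
  by move: jl; rewrite mem_iota.
by exists (u, j); rewrite mem_iota.
Qed.

Hypotheses (D0 : 0 < D) (ul : uniq l) (cl : par_closed [::] wpar size l).
Hypothesis letters : {in l, forall u, all (ltn^~ D) u}.

Lemma word_children u : childcount [::] wpar l u <= D.
Proof.
rewrite /childcount -size_filter -[X in _ <= X](size_iota 0) -(size_map (rcons u)).
apply: uniq_leq_size; first exact: filter_uniq.
move=> v; rewrite mem_filter => /andP[/andP[v0 /eqP <-] vl].
have := letters vl; case/lastP: v v0 {vl} => // v i _; rewrite wpar_rcons all_rcons.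
by move=> /andP[iD _]; rewrite map_f // mem_iota.
Qed.

Lemma nodes_closed : par_closed nroot npar nrank (nodes l).
Proof.
case=> u j; rewrite mem_nodes => /andP[uin jw] ne; rewrite (nrank_npar ne) ltnSn.
split=> //; case: j jw ne => [|j] jw ne; rewrite mem_nodes.
  rewrite prednK // leqnn andbT.
  by have [] := cl uin; first by apply: contraNneq ne => ->.
by rewrite uin ltnW.
Qed.

Lemma nodes_uniq : uniq (nodes l).
Proof. by apply: allpairs_uniq; rewrite ?iota_uniq // => -[u j] [v k] _ _. Qed.

Lemma size_nodes : size (nodes l) = size l * w.
Proof. by rewrite size_allpairs size_iota. Qed.

(** Only the last node of a path branches, to the first nodes of the child words; any other node has
    at most the child [(u, j.+1)]. *)
Lemma node_children a : childcount nroot npar (nodes l) a <= D.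
Proof.
case: a => u j; rewrite /childcount -size_filter.
set s := [seq b <- _ | _]; have us : uniq s by rewrite filter_uniq // nodes_uniq.
case: (eqVneq j w.-1) => jw.
  rewrite -[X in _ <= X](size_iota 0) -(size_map (fun i => (rcons u i, 0))).
  apply: uniq_leq_size us _ => -[v k]; rewrite mem_filter mem_nodes.
  case/andP=> /andP[ne /eqP]; rewrite /npar /=; case: k ne => [|k] ne [] Ev Ek.
    have := letters; move=> /(_ v) lv /andP[vl _]; have := lv vl.
    have : v != [::] by apply: contraNneq ne => ->.
    move: Ev; case/lastP: v {lv vl ne} => // v i; rewrite wpar_rcons => -> _.
    rewrite all_rcons => /andP[iD _].
    by apply: (map_f (fun i => (rcons u i, 0))); rewrite mem_iota.
  by case/andP=> _; rewrite Ek jw prednK // ltnn.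
apply: leq_trans D0; rewrite -[1]/(size [:: (u, j.+1)]).
apply: uniq_leq_size us _ => -[v k]; rewrite mem_filter => /andP[/andP[_ /eqP]].
by case: k => [|k] [Ev Ek]; [rewrite Ek eqxx in jw | rewrite inE Ev Ek].
Qed.

End Words.

(** * The host graph *)

Section Host.
Variables (V I : finType) (Delta : nat) (f : 'I_Delta -> V -> V) (m : nat).

(** A ball contains its centre, so the vertices over one point of [V] form a clique, and those over
    points within [m] directed steps are completely joined. *)
Definition host_rel : rel (V * I) :=
  fun u v => (u != v) && ((v.1 \in ball f m u.1) || (u.1 \in ball f m v.1)).

Lemma host_sym : symmetric host_rel.
Proof. by move=> u v; rewrite /host_rel eq_sym orbC. Qed.

Lemma host_irrefl : irreflexive host_rel.
Proof. by move=> u; rewrite /host_rel eqxx. Qed.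

Definition host : sgraph := SGraph host_sym host_irrefl.

Lemma card_host_edges : #|edges host| <= #|V| * (#|I| ^ 2 * Delta.+1 ^ m).
Proof.
pose P := [set q : (V * I) * (V * I) | q.2.1 \in ball f m q.1.1].
have sub : edges host \subset [set [set q.1; q.2] | q : (V * I) * (V * I) in P].
  apply/subsetP=> _ /imset2P[u v _ uv ->].
  move: uv; rewrite inE => /andP[_ /andP[_ /orP[uv|uv]]].
    by apply/imsetP; exists (u, v); rewrite ?inE.
  by apply/imsetP; exists (v, u); rewrite ?inE //= setUC.
apply: leq_trans (subset_leq_card sub) (leq_trans (leq_imset_card _ _) _).
have -> : #|P| = \sum_(u : V * I) #|setX (ball f m u.1) [set: I]|.
  rewrite -sum1_card (partition_big (fun q => q.1) xpredT) //=.
  apply: eq_bigr => u _; rewrite -sum1_card.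
  rewrite (reindex_onto (fun v => (u, v)) snd) /=; last first.
    by move=> [a b] /andP[_ /eqP /= ->].
  by apply: eq_bigl => -[a b]; rewrite /= !inE /= !eqxx !andbT.
apply: leq_trans (_ : \sum_(u : V * I) (Delta.+1 ^ m * #|I|) <= _).
  by apply: leq_sum => u _; rewrite cardsX cardsT leq_mul2r card_ball orbT.
rewrite sum_nat_const card_prod expnS expn1; apply: eq_leq; lia.
Qed.
End Host.

(** * Embedding a graph along its tree partition *)

Section Copies.
Variables (H : sgraph) (D w : nat) (addr : H -> seq nat).
Hypothesis lay : layout (@sedge H) [set: H] D w addr.

Definition words : seq (seq nat) := undup [seq addr x | x <- enum H].

Lemma mem_words x : addr x \in words.
Proof. by rewrite mem_undup map_f // mem_enum. Qed.

Lemma words_ex u : u \in words -> exists x, u = addr x.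
Proof. by rewrite mem_undup => /mapP[x _ ->]; exists x. Qed.

Lemma size_words : size words <= #|H|.
Proof. by apply: leq_trans (size_undup _) _; rewrite size_map cardE. Qed.

Lemma words_closed : par_closed [::] wpar size words.
Proof.
have [_ _ _ prefix] := lay.
move=> u /words_ex[x ux] u0; rewrite (size_wpar u0) ltnSn; split=> //.
case/lastP: u u0 ux => // u i _ ux; rewrite wpar_rcons.
have [y _ <-] := prefix x (in_setT _) u i (esym ux); exact: mem_words.
Qed.

Lemma words_letters : {in words, forall u, all (ltn^~ D) u}.
Proof. by have [lt _ _ _] := lay; move=> u /words_ex[x ->]; exact: lt. Qed.

Definition pos x := index x (enum [set y | addr y == addr x]).

Lemma pos_lt x : pos x < w.
Proof.
have [_ _ card_bag _] := lay; apply: leq_trans (card_bag (addr x)).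
have -> : #|[set y in [set: H] | addr y == addr x]| = size (enum [set y | addr y == addr x]).
  by rewrite -cardE; apply: eq_card => y; rewrite !inE.
by rewrite index_mem mem_enum inE.
Qed.

Lemma pos_inj x y : addr x = addr y -> pos x = pos y -> x = y.
Proof.
rewrite /pos => E; rewrite E => /(index_inj x); apply; by rewrite mem_enum inE ?E.
Qed.

Lemma layout_edge x y : sedge x y -> adjacent_addr (addr x) (addr y).
Proof. by have [_ adj _ _] := lay; apply: adj; rewrite inE. Qed.

Variables (V I : finType) (Delta : nat) (f : 'I_Delta -> V -> V) (m : nat).
Variable col : {set host I f m} -> bool.
Variable b : bool.
Let blue := colour_rel col b.

(** Each bag goes into [A] or [B] over the image of its word, according to the side of that image.
    Edges inside a bag are blue because [S] spans a blue clique there, and edges between bags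
    because the copy of the tree consists of blue bicliques. *)
Lemma blue_embedding (i0 : I) (S A B : {set I}) (U : {set V}) :
  A \subset S -> B \subset S -> w <= #|A| -> w <= #|B| ->
  {in U, forall v, {in S &, forall i j, i != j -> blue (v, i) (v, j)}} ->
  bipartite_copy [::] wpar words
    [rel x y | [forall i in A, forall j in B, blue (x, i) (y, j)]] U ->
  is_subgraph H (colour_class col b).
Proof.
move=> AS BS Aw Bw clq [X [phi [pI pU pE]]].
pose C v := if v \in X then A else B.
have CS v : C v \subset S by rewrite /C; case: ifP.
have Cw v : w <= #|C v| by rewrite /C; case: ifP.
pose emb x := (phi (addr x), nth i0 (enum (C (phi (addr x)))) (pos x)).
have pos_size x v : pos x < size (enum (C v)).
  by rewrite -cardE; apply: leq_trans (pos_lt x) (Cw v).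
have embC x : (emb x).2 \in C (phi (addr x)).
  by rewrite -mem_enum mem_nth.
have embI : injective emb.
  move=> x y [/(pI _ _ (mem_words x) (mem_words y)) E]; rewrite E => /eqP.
  by rewrite nth_uniq ?enum_uniq // => /eqP; exact: pos_inj.
exists emb => // x y xy; rewrite /= -/blue.
have down x' y' i : addr y' = rcons (addr x') i -> blue (emb x') (emb y').
  move=> E; have := pE (addr y') (mem_words y').
  rewrite E wpar_rcons -E => /(_ _); have -> : addr y' != [::] by rewrite E; case: (addr x').
  move=> /(_ isT); have := embC x'; have := embC y'; rewrite /C /=.
  case: ifP => yX; case: ifP => xX //=.
    move=> yA xB /forallP/(_ (emb y').2)/implyP/(_ yA).
    by move=> /forallP/(_ (emb x').2)/implyP/(_ xB); rewrite /blue colour_rel_sym.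
  move=> yB xA /forallP/(_ (emb x').2)/implyP/(_ xA).
  by move=> /forallP/(_ (emb y').2)/implyP/(_ yB).
case: (layout_edge xy) => [E|[i E]|[i E]].
- have := clq (phi (addr x)) (pU _ (mem_words x)) (emb x).2 (emb y).2.
  rewrite (subsetP (CS _) _ (embC x)) (subsetP (CS _) _ (embC y)) => /(_ isT isT).
  rewrite /emb /= E; apply; rewrite nth_uniq ?enum_uniq //.
  by apply: contraTneq xy => /(pos_inj E) ->; rewrite sedge_irrefl.
- exact: down E.
- by rewrite /blue colour_rel_sym; exact: down E.
Qed.

(** A vertex goes to the node given by its word and its position in the bag. Adjacent vertices have
    equal or adjacent words, so their nodes are near by [near_nodes], and the host edge between them
    is not blue. *)
Lemma red_embedding (phi : seq nat * nat -> V) (g : seq nat * nat -> I) :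
  0 < w -> m = 2 * w ->
  {in nodes w words &, injective phi} ->
  {in nodes w words &, forall a c, near (npar w) (nrank w) m a c ->
    ((phi c \in ball f m (phi a)) || (phi a \in ball f m (phi c))) &&
    ~~ blue (phi a, g a) (phi c, g c)} ->
  is_subgraph H (colour_class col (~~ b)).
Proof.
move=> w0 mw pI red; pose node x := (addr x, pos x).
have node_in x : node x \in nodes w words by rewrite mem_nodes // mem_words pos_lt.
have nodeI x y : node x = node y -> x = y by case=> E; exact: pos_inj.
exists (fun x => (phi (node x), g (node x))).
  by move=> x y [/(pI _ _ (node_in x) (node_in y))/nodeI].
move=> x y xy; have ne : node x != node y.
  by apply: contraTneq xy => /nodeI ->; rewrite sedge_irrefl.
have nr : near (npar w) (nrank w) m (node x) (node y).
  by rewrite mw; apply: near_nodes; rewrite ?pos_lt //; exact: layout_edge.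
have := red _ _ (node_in x) (node_in y) nr => /andP[bl].
rewrite /blue /= /colour_rel /= /host_rel /= bl andbT.
have -> : (phi (node x), g (node x)) != (phi (node y), g (node y)).
  by apply: contra ne => /eqP[/(pI _ _ (node_in x) (node_in y)) -> _].
by move=> /=; case: (col _); case: (b).
Qed.
End Copies.

Lemma ball_refl (V : finType) Delta (f : 'I_Delta -> V -> V) m x : x \in ball f m x.
Proof. by apply: (subsetP (ball_leq f x (leq0n m))); rewrite inE. Qed.

Lemma layout_ramsey (w D : nat) : 0 < w -> 0 < D -> exists c, forall n, 0 < n ->
  exists2 G : sgraph, #|edges G| <= c * n &
  forall (H : sgraph) (addr : H -> seq nat), #|H| <= n ->
    layout (@sedge H) [set: H] D w addr -> ramsey_for G H.
Proof.
move=> w0 D0; have [m Em] : exists m, m = 2 * w by exists (2 * w).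
have m0 : 0 < m by rewrite Em muln_gt0.
(* [s] is the size of a monochromatic clique that suffices for the transversal; by [ramsey_sets],
   [t = 2 ^ (s + s)] vertices ensure one. *)
have [s Es] : exists s, s = candidates w (m * (D ^ m + 1)) (m * (D ^ m + 1)) by eexists.
have [t Et] : exists t, t = 2 ^ (s + s) by eexists.
pose Tau : finType := ({set 'I_t} * {set 'I_t})%type.
have i0 : 'I_t by exists 0; rewrite Et expn_gt0.
(* [M] bounds the number of triples of two parts and a pair of subsets, hence of shrinking steps. *)
have [M EM] : exists M, M = m * m * #|Tau| by eexists.
(* [lam * n'] is the part size that [red_copy] requires. *)
have [lam Elam] : exists lam, lam = D.+2 * (m + 2) + 1 by eexists.
have lam0 : 0 < lam by rewrite Elam addn1.
have shrink0 : 0 < shrink D by rewrite /shrink addn1.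
pose J : finType := (bool * {set 'I_t})%type.
have J1 : 1 < #|J|.
  rewrite card_prod card_bool; apply: leq_pmulr.
  by apply/card_gt0P; exists set0.
(* The factors pay in turn for the pigeonhole over colour and position, the split into [m] parts,
   the [M] shrinkings and the final part size. *)
have [q Eq] : exists q, q = #|J| * (m * (shrink D ^ M * lam)) by eexists.
have q1 : 1 < q.
  by rewrite Eq; apply: leq_trans J1 _;
    rewrite leq_pmulr // !muln_gt0 m0 lam0 expn_gt0 shrink0.
have [Delta exp_n] := expander_ex q1.
exists (q * w * (t ^ 2 * Delta.+1 ^ m)) => n n0.
have [n' En] : exists n', n' = n * w by eexists.
have n'0 : 0 < n' by rewrite En muln_gt0 n0.
have [f expand] := exp_n n' n'0.
set V := 'I_(q * n') in f expand.
exists (host 'I_t f m) => [|H addr Hn lay col].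
  apply: leq_trans (card_host_edges 'I_t f m) _; rewrite !card_ord En.
  by apply: eq_leq; lia.
have homog (v : V) : exists k : J, #|k.2| = s /\
    {in k.2 &, forall i j, i != j -> col [set (v, i); (v, j)] = k.1}.
  have [||c [S]] := @ramsey_sets 'I_t (fun i j => col [set (v, i); (v, j)])
    (s + s) s s [set: 'I_t] _ (leqnn _).
  - by move=> i j; rewrite setUC.
  - by rewrite cardsT card_ord Et.
  by rewrite if_same => Ss [_ Sc]; exists (c, S).
have /choice[k kP] := homog.
have [|[b S] big] := @pigeonhole V J k (m * (shrink D ^ M * lam * n')) (ltnW J1).
  by rewrite card_ord Eq; apply: eq_leq; lia.
set U := [set x | _] in big.
have kU x : x \in U -> k x = (b, S) by rewrite in_set => /eqP.
have Ss : #|S| = s.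
  have /card_gt0P[x xU] : 0 < #|U|.
    by apply: leq_trans big; rewrite !muln_gt0 m0 lam0 n'0 expn_gt0 shrink0.
  by have [+ _] := kP x; rewrite kU.
have [p pK] := split_in_parts big.
pose U0 := [set x in U | p x < m].
have U0part i : i < m -> part p U0 i = part p U i.
  move=> im; apply/setP=> x; rewrite !in_set;
    case: (eqVneq (p x) i) => [->|_]; last by rewrite !andbF.
  by rewrite im !andbT.
pose blue := colour_rel col b.
pose E (tau : Tau) := [rel x y : V |
  [forall i in tau.1, forall j in tau.2, blue (x, i) (y, j)]].
pose P (x : nat * nat * Tau) := [&& x.1.1 != x.1.2, x.2.1 \subset S, x.2.2 \subset S,
  w <= #|x.2.1| & w <= #|x.2.2|].
pose pairs := [seq (i, j) | i <- iota 0 m, j <- iota 0 m].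
pose ts := [seq x <- [seq (ij, tau) | ij <- pairs, tau <- enum Tau] | P x].
have ts_M : size ts <= M.
  rewrite size_filter; apply: leq_trans (count_size _ _) _.
  by rewrite !size_allpairs !size_iota -cardE EM.
have mem_ts i j tau : i < m -> j < m -> P (i, j, tau) -> (i, j, tau) \in ts.
  move=> im jm Pt; rewrite mem_filter Pt; apply: allpairs_f; last by rewrite mem_enum.
  by apply: allpairs_f; rewrite mem_iota.
have ul := undup_uniq [seq addr x | x <- enum H]; rewrite -/(words addr) in ul.
have lett := words_letters lay; have wcl := words_closed lay.
have sw : size (words addr) <= n'.
  by apply: leq_trans (leq_trans (size_words addr) Hn) _; rewrite En leq_pmulr.
(* A bipartite copy gives [H] in colour [b]; otherwise the remaining parts have no [b]-coloured
   biclique on [w]-subsets of [S] between them, and [H] appears in the other colour. *)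
have [||||[[[i j] [A B]] /= tts copy]|[U' [U'U U'big noE]]] :=
  @shrink_all V _ [::] wpar size (words addr) D n' erefl ul wcl
    (word_children ul lett) sw p Tau E m ts U0 (lam * n').
- by rewrite muln_gt0 lam0.
- by rewrite leq_pmull.
- move=> x; rewrite mem_filter => /andP[/andP[ne _] /allpairsP[[ij tau] /= [ijp _ Ex]]].
  move: ijp => /allpairsP[[i j] /= [im jm Eij]]; move: ne im jm.
  by rewrite Ex Eij !mem_iota !add0n /=; split.
- move=> i im; rewrite U0part //; apply: leq_trans (pK i im).
  by rewrite -mulnA leq_mul2r leq_pexp2l ?orbT.
- exists b; move: tts; rewrite mem_filter => /andP[/and5P[/= _ AS BS Aw Bw] _].
  apply: (blue_embedding lay i0 AS BS Aw Bw _ copy).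
  move=> v; rewrite inE => /andP[/kU kv _] i' j' iS jS ij'.
  have [_ cv] := kP v; rewrite kv /= in cv.
  rewrite /colour_rel (cv _ _ iS jS ij') eqxx andbT /= /host_rel /= ball_refl /= andbT.
  by apply: contra ij' => /eqP[->].
have U'm x : x \in U' -> p x < m by move=> /(subsetP U'U); rewrite inE => /andP[].
have nrank_par : {in nodes w (words addr), forall a, a != nroot ->
    nrank w a = (nrank w (npar w a)).+1} by move=> a _; exact: nrank_npar.
have sn : size (nodes w (words addr)) <= n'.
  by rewrite size_nodes En leq_mul2r (leq_trans (size_words addr) Hn) orbT.
have [|i im|x y xU' yU' ne A B AS BS Aw Bw||phi [g [pI red]]] :=
  @red_copy V 'I_t Delta f _ nroot (npar w) (nrank w) (nodes w (words addr)) D n' erefl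
  (nodes_uniq w ul) (nodes_closed w0 wcl) nrank_par (node_children w0 D0 ul lett) sn
  i0 U' p m w S blue D0 m0 n'0 w0 _ U'm _ expand.
- exact: (@colour_rel_sym (host 'I_t f m) col b).
- apply: leq_trans (U'big i im); rewrite Elam; apply: eq_leq; lia.
- have tin : (p x, p y, (A, B)) \in ts.
    by apply: mem_ts; rewrite ?U'm //; apply/and5P; split.
  have := noE _ tin x y; rewrite !in_set xU' yU' !eqxx => /(_ isT isT) /=.
  case/forallPn=> i; rewrite negb_imply => /andP[iA /forallPn[j]].
  by rewrite negb_imply => /andP[jB nb]; exists i, j.
- by rewrite Ss Es.
by exists (~~ b); apply: (red_embedding lay w0 Em pI red).
Qed.

(** * Separators from treewidth, and the conclusion *)

Lemma treewidth_cliques (H : sgraph) (k : int) : (treewidth H <= k)%R ->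
  exists (C : sgraph) (phi : H -> C), [/\ chordal C, injective phi, {homo phi : x y / sedge x y}
    & forall S : {set C}, clique S -> #|S| <= absz (k + 1)%R].
Proof.
rewrite /treewidth; case: ex_minnP => n /asboolP[C [chC [phi phiI phiE] noclique]] _ le.
exists C, phi; split=> // S cS; rewrite leqNgt; apply/negP => lt.
(* [noclique] excludes only the exact size [n.+1], but a larger clique contains one of that size. As
   [n - 1 <= k], the integer [k + 1] is nonnegative and [absz] keeps it. *)
have /card_geqP[s [us ss sS]] : n.+1 <= #|S| by move: le lt; lia.
apply: (noclique [set x in s]).
  by move=> x y; rewrite !inE => xs ys; apply: cS; apply: sS.
by rewrite cardsE (card_uniqP us).
Qed.

(** The chordal supergraph is pulled back to [H] along [phi]. The relation [e] contains the edges of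
    [H] and inherits the triangle property, as cycles map injectively to cycles; so its clique
    separators also separate [H]. *)
Lemma treewidth_separator (H : sgraph) (k : int) : (treewidth H <= k)%R ->
  forall P Y : {set H}, exists Q A : {set H},
  [/\ Q \subset P, #|Q| <= absz (k + 1)%R, A \subset P :\: Q,
  {in A, forall x, {in P :\: Q, forall y, sedge x y -> y \in A}} &
  3 * #|Y :&: A| <= 2 * #|Y| /\ 3 * #|Y :&: ((P :\: Q) :\: A)| <= 2 * #|Y|].
Proof.
move=> /treewidth_cliques[C [phi [chC phiI phiE cliques]]] P Y.
pose e : rel H := fun x y => sedge (phi x) (phi y).
have tri x y p : e x y -> path e y p -> p != [::] -> e (last y p) x ->
    uniq (x :: y :: p) -> exists z, [/\ z \in p, e x z & e y z].
  move=> xy yp p0 lx up.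
  have [||||_ [/mapP[z zp ->] xz yz]] :=
    @chordal_triangle C (phi x) (phi y) (map phi p) chC xy.
  - by rewrite path_map.
  - by case: (p) p0.
  - by rewrite last_map.
  - by rewrite -!map_cons map_inj_uniq.
  by exists z.
have eC : symmetric e by move=> x y; exact: sedge_sym.
have [Q [A [QP cQ AW clA [YA YB]]]] := balanced_separator eC tri P Y.
exists Q, A; split=> // [|x xA y yW xy]; last exact: clA xA _ yW (phiE _ _ xy).
rewrite -(card_imset _ phiI); apply: cliques => _ _ /imsetP[x xQ ->] /imsetP[y yQ ->] ne.
by apply: cQ => //; apply: contra ne => /eqP->.
Qed.

Lemma size_ramsey_min (G H : sgraph) : ramsey_for G H -> size_ramsey H <= #|edges G|.
Proof.
move=> GH; rewrite /size_ramsey; case: ex_minnP => n _; apply.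
by apply/asboolP; exists G.
Qed.

Theorem theorem1p1 (k d : int) :
  exists c : nat, forall H : sgraph,
    (max_degree H)%:Z%R = d -> (treewidth H <= k)%R ->
    size_ramsey H <= c * #|H|.
Proof.
pose kappa := absz (k + 1)%R; pose delta := absz d.
have [||c cP] := @layout_ramsey (bag delta kappa) (branching delta kappa).
- by rewrite addn_gt0.
- by rewrite expn_gt0.
exists c => H degH twH.
(* For empty [H] the bound is 0, and [H] itself is a host without edges. *)
have [H0|Hpos] := posnP #|H|.
  rewrite H0 muln0; have : #|edges H| = 0.
    apply/eqP; rewrite cards_eq0 -subset0; apply/subsetP=> A /imset2P[x].
    by case: (fintype0 x H0).
  move=> <-; apply: size_ramsey_min => col; exists true.
  by exists id => // x; case: (fintype0 x H0).
have [G edgesG ramG] := cP #|H| Hpos.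
apply: leq_trans edgesG; apply: size_ramsey_min.
have deg (x : H) : #|[set y | sedge x y]| <= delta.
  by rewrite /delta -degH; exact: (@leq_bigmax _ (fun x : H => #|[set y | sedge x y]|) x).
have [x0 _] : exists x0 : H, x0 \in H by apply/card_gt0P.
have [||_|addr [lay _]] := tree_partition (@sedge_sym H) deg (treewidth_separator twH)
  (P := [set: H]) (S := [set x0]).
- exact: subsetT.
- by rewrite cards1.
- by apply/set0Pn; exists x0; rewrite inE.
exact: ramG lay.
Qed.
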